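(* Let $\mathbb G$ be a step 2 Carnot group with CC distance $d$, and let $g:\mathbb G\to\mathbb R$ be bounded and lower semicontinuous. Let $\Phi:[0,+\infty)\to[0,+\infty)$ be continuous, convex, non-decreasing, with $\Phi(0)=0$, coercive in the sense $\Phi(\tau)/\tau\to+\infty$ as $\tau\to+\infty$, and such that its even extension $\widetilde\Phi(s)=\Phi(|s|)$ is locally strongly convex in $\mathbb R$. Let $\Phi^*(s)=\sup_{\tau\ge0}\{s\tau-\Phi(\tau)\}$ for $s\ge0$ and $$u(t,p)=\inf_{q\in\mathbb G}\Big\{g(q)+t\,\Phi^*\Big(\frac{d(p,q)}{t}\Big)\Big\},\qquad t>0,\ p\in\mathbb G$$ (the Hopf–Lax viscosity solution of $u_t+\Phi(|\nabla_Hu|)=0$, $u(0,\cdot)=g$). Then for every $t>0$, $u(t,\cdot)$ is h-semiconcave in $\mathbb G$.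
   Context: A step 2 Carnot group is identified with $\mathbb R^n=\mathbb R^m\times\mathbb R^{n_2}$ with law $p\cdot q=(p^{(1)}+q^{(1)},p^{(2)}+q^{(2)}+\mathcal B(p^{(1)},q^{(1)}))$, $\mathcal B$ skew-symmetric bilinear, identity $0$, $p^{-1}=-p$; $X_1,\dots,X_m$ are the left-invariant fields equal to $\partial/\partial p_i$ at $0$, $\nabla_Hu=(X_1u,\dots,X_mu)$; CC distance $d(p,q)$ = infimum of $\int_0^1|u|$ over absolutely continuous curves from $p$ to $q$ with $\dot\gamma=\sum u_iX_i(\gamma)$ a.e. $\mathcal H_0=\mathbb R^m\times\{0\}$, $|\cdot|$ Euclidean norm. A lower semicontinuous $v$ on $\mathbb G$ is h-semiconcave if there is $C\ge0$ with $v(p\cdot h)+v(p\cdot h^{-1})-2v(p)\le C|h|^2$ for all $p\in\mathbb G$, $h\in\mathcal H_0$. A function $f$ on $\mathbb R$ is locally strongly convex if for every compact interval $K$ there is $C(K)>0$ with $\lambda f(x)+(1-\lambda)f(y)-f(\lambda x+(1-\lambda)y)\ge\lambda(1-\lambda)C(K)|x-y|^2$ for all $x,y\in K$, $\lambda\in[0,1]$. *)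

(* Defs.v *)
From mathcomp Require Import all_boot all_order all_algebra.
From mathcomp Require Import all_classical all_reals all_analysis.
Import numFieldNormedType.Exports.
Import Order.TTheory GRing.Theory Num.Theory.

Set Implicit Arguments.
Unset Strict Implicit.
Unset Printing Implicit Defensive.

Local Open Scope classical_set_scope.
Local Open Scope ring_scope.

Section Carnot.
Variable R : realType.

(* Points of G = R^m x R^n2, first layer and second layer. *)
Definition carnot_pt (m n2 : nat) := ('rV[R]_m * 'rV[R]_n2)%type.

Definition enorm (k : nat) (v : 'rV[R]_k) : R := Num.sqrt (\sum_(i < k) v 0 i ^+ 2).

Definition skew_bilinear (m n2 : nat) (B : 'rV[R]_m -> 'rV[R]_m -> 'rV[R]_n2) :=
  (forall (a : R) x y z, B (a *: x + y) z = a *: B x z + B y z) /\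
  (forall x y, B x y = - B y x).

(* Stratification for step 2: the second layer is spanned by the brackets,
   i.e. the linear span of the range of B is all of R^n2. *)
Definition B_spanning (m n2 : nat) (B : 'rV[R]_m -> 'rV[R]_m -> 'rV[R]_n2) :=
  forall w : 'rV[R]_n2, exists (k : nat) (xs ys : 'I_k -> 'rV[R]_m),
    w = \sum_(i < k) B (xs i) (ys i).

Definition gmul (m n2 : nat) (B : 'rV[R]_m -> 'rV[R]_m -> 'rV[R]_n2)
  (p q : carnot_pt m n2) : carnot_pt m n2 := (p.1 + q.1, p.2 + q.2 + B p.1 q.1).
Definition ginv (m n2 : nat) (p : carnot_pt m n2) : carnot_pt m n2 := (- p.1, - p.2).

Definition hor (m n2 : nat) (h : 'rV[R]_m) : carnot_pt m n2 := (h, 0).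

Definition abs_cont01 (f : R -> R) :=
  forall eps : R, 0 < eps -> exists2 delta : R, 0 < delta &
    forall (k : nat) (a b : nat -> R),
      (forall i, (i < k)%N -> 0 <= a i /\ a i <= b i /\ b i <= 1) ->
      (forall i, (i.+1 < k)%N -> b i <= a i.+1) ->
      \sum_(i < k) (b i - a i) < delta ->
      \sum_(i < k) `|f (b i) - f (a i)| < eps.

(* Admissible (horizontal) curve from p to q with control u:
   gamma absolutely continuous on [0,1] (componentwise), u measurable and
   gamma' = sum_i u_i X_i(gamma) a.e. on [0,1].  Here the left-invariant
   field X_i equal to d/dp_i at 0 is X_i(p) = (e_i, B(p^(1), e_i)), so
   sum_i u_i X_i(p) = (u, B(p^(1), u)) by linearity of B. *)
Definition admissible (m n2 : nat) (B : 'rV[R]_m -> 'rV[R]_m -> 'rV[R]_n2)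
  (p q : carnot_pt m n2) (gamma : R -> carnot_pt m n2) (u : R -> 'rV[R]_m) :=
  [/\ gamma 0 = p /\ gamma 1 = q,
      (forall j : 'I_m, abs_cont01 (fun t => (gamma t).1 0 j)) /\
      (forall j : 'I_n2, abs_cont01 (fun t => (gamma t).2 0 j)),
      (forall j : 'I_m, measurable_fun (`[0, 1] : set R) (fun t => u t 0 j)) &
      {ae (@lebesgue_measure R), forall t : R, t \in `]0, 1[%R ->
         (forall j : 'I_m, derivable (fun s => (gamma s).1 0 j) t 1 /\
                    derive1 (fun s => (gamma s).1 0 j) t = u t 0 j) /\
         (forall j : 'I_n2, derivable (fun s => (gamma s).2 0 j) t 1 /\
                    derive1 (fun s => (gamma s).2 0 j) t = B (gamma t).1 (u t) 0 j)}].

Definition ctrl_length (m : nat) (u : R -> 'rV[R]_m) : \bar R :=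
  \int[@lebesgue_measure R]_(t in (`[0%R, 1%R]%classic : set R)) (enorm (u t))%:E.

(* Carnot-Caratheodory distance (finite by Chow's theorem under B_spanning) *)
Definition ccdist (m n2 : nat) (B : 'rV[R]_m -> 'rV[R]_m -> 'rV[R]_n2)
  (p q : carnot_pt m n2) : R :=
  fine (ereal_inf [set L | exists gamma u, admissible B p q gamma u /\ L = ctrl_length u]).

Definition conjugate (Phi : R -> R) (s : R) : R :=
  sup [set s * tau - Phi tau | tau in `[0, +oo[].

Definition hopf_lax (m n2 : nat) (B : 'rV[R]_m -> 'rV[R]_m -> 'rV[R]_n2)
  (g : carnot_pt m n2 -> R) (Phi : R -> R) (t : R) (p : carnot_pt m n2) : R :=
  inf [set g q + t * conjugate Phi (ccdist B p q / t) | q in [set: carnot_pt m n2]].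

Definition loc_strongly_convex (f : R -> R) :=
  forall a b : R, a <= b -> exists2 C : R, 0 < C &
    forall x y lam, a <= x <= b -> a <= y <= b -> 0 <= lam <= 1 ->
      lam * (1 - lam) * C * `|x - y| ^+ 2 <=
      lam * f x + (1 - lam) * f y - f (lam * x + (1 - lam) * y).

Definition h_semiconcave (m n2 : nat) (B : 'rV[R]_m -> 'rV[R]_m -> 'rV[R]_n2)
  (v : carnot_pt m n2 -> R) :=
  lower_semicontinuous (fun x => (v x)%:E) /\
  exists2 C : R, 0 <= C & forall (p : carnot_pt m n2) (h : 'rV[R]_m),
    v (gmul B p (hor n2 h)) + v (gmul B p (ginv (hor n2 h))) - 2 * v p
      <= C * enorm h ^+ 2.

End Carnot.

(* Main.v *)
Require Import Defs.
From mathcomp Require Import all_boot all_order all_algebra.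
From mathcomp Require Import all_classical all_reals all_analysis.
From mathcomp Require Import measurable_realfun.
From mathcomp Require Import perm ring lra.
Import numFieldNormedType.Exports.
Import Order.TTheory GRing.Theory Num.Theory.
Set Implicit Arguments.
Unset Strict Implicit.
Unset Printing Implicit Defensive.
Local Open Scope classical_set_scope.
Local Open Scope ring_scope.

(* The core is the inequality
     d(p h)^2 + d(p h^-1)^2 <= 2 d(p)^2 + C |h|^2
   for horizontal h, with C depending only on the dimension of the first layer.
   Approximate a nearly minimal curve by polygons w_0, ..., w_(N-1) of horizontal
   increments.  Adding phi_i h to w_i, with sum of the phi_i equal to 1, moves the
   endpoint in the first layer by h and in the second layer linearly in h, and the
   endpoint becomes p h when the phi-average of the edge midpoints is the end
   of the polygon.  Minimisers of an energy penalised at the endpoint satisfy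
   w_(i+1) = w_i A for a Cayley transform A, which is orthogonal, so by
   Cayley-Hamilton applied to the powers of A the end of the polygon is an average
   of earlier midpoints with weights phi_i = O(1/N), uniformly in A.  Hence the
   perturbation costs only O(|h|^2) in energy, and the first-order terms for h and
   -h cancel.

   Strong convexity of Phi makes its conjugate C^(1,1) with derivative O(s) at s,
   so the inequality passes to Phi^*(d/t), and then to the infimum by testing with
   a nearly optimal q.  Lower semicontinuity follows because Phi^* is locally
   Lipschitz and nearly optimal q stay at bounded distance. *)

(** * Euclidean norm *)

(** Right multiplication of the endpoint by [h] imposes two linear conditions on the weights: total
    mass one, and average of the edge midpoints equal to the endpoint. For a straight polygon the
    endpoint lies outside the convex hull of the earlier midpoints, so the weights must be signed:
    the average is an extrapolation. Size O(1/N) is the right one because the energy of N edges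
    carries a factor N: it multiplies N squares of order 1/N^2. The matrix [A] depends on a
    multiplier for which no bound is available; orthogonality bounds the coefficients of its
    characteristic polynomial all the same.

    The square of the distance is used because the distance has a corner at the identity, where d(h)
    + d(h^-1) = 2|h|. The conjugate must therefore have slope O(s) at s: this factor turns c(a + b -
    2c) into half of a^2 + b^2 - 2c^2, up to terms of the favourable sign.

    Boundedness of [g] confines nearly optimal points to a fixed radius, so that one Lipschitz
    constant and one convexity modulus of the conjugate problem serve for all [p]; it also settles
    |h| >= 1 outright. *)

Section Euclidean.
Context (R : realType).
Implicit Types (k : nat).

Definition dotp k (x y : 'rV[R]_k) : R := \sum_(i < k) x 0 i * y 0 i.

Lemma dotpC k (x y : 'rV[R]_k) : dotp x y = dotp y x.
Proof. by apply: eq_bigr => i _; rewrite mulrC. Qed.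

Lemma dotpDl k (x y z : 'rV[R]_k) : dotp (x + y) z = dotp x z + dotp y z.
Proof. by rewrite -big_split; apply: eq_bigr => i _; rewrite mxE mulrDl. Qed.

Lemma dotpDr k (x y z : 'rV[R]_k) : dotp z (x + y) = dotp z x + dotp z y.
Proof. by rewrite dotpC dotpDl !(dotpC z). Qed.

Lemma dotpZl k a (x y : 'rV[R]_k) : dotp (a *: x) y = a * dotp x y.
Proof. by rewrite mulr_sumr; apply: eq_bigr => i _; rewrite mxE mulrA. Qed.

Lemma dotpZr k a (x y : 'rV[R]_k) : dotp x (a *: y) = a * dotp x y.
Proof. by rewrite dotpC dotpZl dotpC. Qed.

Lemma dotpNl k (x y : 'rV[R]_k) : dotp (- x) y = - dotp x y.
Proof. by rewrite -scaleN1r dotpZl mulN1r. Qed.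

Lemma dotpNr k (x y : 'rV[R]_k) : dotp x (- y) = - dotp x y.
Proof. by rewrite dotpC dotpNl dotpC. Qed.

Lemma dotp0l k (x : 'rV[R]_k) : dotp 0 x = 0.
Proof. by rewrite -(scale0r x) dotpZl mul0r. Qed.

Lemma enorm2E k (x : 'rV[R]_k) : enorm x ^+ 2 = dotp x x.
Proof. by rewrite sqr_sqrtr // sumr_ge0 // => i _; rewrite sqr_ge0. Qed.

Lemma enorm_ge0 k (x : 'rV[R]_k) : 0 <= enorm x.
Proof. exact: sqrtr_ge0. Qed.

Lemma dotp_ge0 k (x : 'rV[R]_k) : 0 <= dotp x x.
Proof. by rewrite -enorm2E sqr_ge0. Qed.

Lemma dotp_eq0 k (x : 'rV[R]_k) : dotp x x = 0 -> x = 0.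
Proof.
move=> x0; apply/rowP => i; rewrite mxE; apply/eqP; rewrite -sqrf_eq0; apply/eqP.
by move: i isT; apply/psumr_eq0P; first by move=> i _; rewrite sqr_ge0.
Qed.

Lemma enorm0 k : enorm (0 : 'rV[R]_k) = 0.
Proof. by apply/eqP; rewrite -sqrf_eq0 enorm2E dotp0l. Qed.

Lemma enormZ k a (x : 'rV[R]_k) : enorm (a *: x) = `|a| * enorm x.
Proof.
apply/eqP; rewrite -(@eqrXn2 _ 2) ?mulr_ge0 ?enorm_ge0 //.
by rewrite exprMn !enorm2E dotpZl dotpZr mulrA -expr2 real_normK ?num_real.
Qed.

Lemma enormN k (x : 'rV[R]_k) : enorm (- x) = enorm x.
Proof. by rewrite -scaleN1r enormZ normrN normr1 mul1r. Qed.

Lemma enormB k (x y : 'rV[R]_k) : enorm (x - y) = enorm (y - x).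
Proof. by rewrite -opprB enormN. Qed.

Lemma dotp_le k (x y : 'rV[R]_k) : dotp x y <= enorm x * enorm y.
Proof.
have [/eqP x0|x0] := boolP (enorm x == 0).
  by rewrite (dotp_eq0 (x := x)) ?dotp0l ?enorm0 ?mul0r // -enorm2E x0 expr0n.
have [/eqP y0|y0] := boolP (enorm y == 0).
  by rewrite dotpC (dotp_eq0 (x := y)) ?dotp0l ?enorm0 ?mulr0 // -enorm2E y0 expr0n.
have xp : 0 < enorm x by rewrite lt_neqAle eq_sym x0 enorm_ge0.
have yp : 0 < enorm y by rewrite lt_neqAle eq_sym y0 enorm_ge0.
have := dotp_ge0 (enorm y *: x - enorm x *: y).
rewrite dotpDl !dotpDr !(dotpNl, dotpNr, dotpZl, dotpZr) -!enorm2E (dotpC y x).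
have := mulr_gt0 xp yp; nra.
Qed.

Lemma enormD k (x y : 'rV[R]_k) : enorm (x + y) <= enorm x + enorm y.
Proof.
rewrite -(@ler_pXn2r _ 2) ?nnegrE ?addr_ge0 ?enorm_ge0 //.
rewrite enorm2E dotpDl !dotpDr (dotpC y x) sqrrD -!enorm2E.
have := dotp_le x y; lra.
Qed.

Lemma enorm_sum k (I : Type) (r : seq I) (P : pred I) (F : I -> 'rV[R]_k) :
  enorm (\sum_(i <- r | P i) F i) <= \sum_(i <- r | P i) enorm (F i).
Proof.
elim/big_rec2: _ => [|i x y _ le_yx]; first by rewrite enorm0.
by apply: le_trans (enormD _ _) _; rewrite lerD2l.
Qed.

Lemma coord_le_enorm k (x : 'rV[R]_k) i : `|x 0 i| <= enorm x.
Proof.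
rewrite -(@ler_pXn2r _ 2) ?nnegrE ?enorm_ge0 // real_normK ?num_real // enorm2E.
by rewrite /dotp (bigD1 i) //= expr2 lerDl sumr_ge0 // => j _; rewrite -expr2 sqr_ge0.
Qed.

Lemma enorm_delta k (i : 'I_k) : enorm (delta_mx 0 i : 'rV[R]_k) = 1.
Proof.
apply/eqP; rewrite -(@eqrXn2 _ 2) ?enorm_ge0 // enorm2E expr1n /dotp (bigD1 i) //=.
rewrite big1 ?addr0 ?mxE ?eqxx ?mulr1 // => j ji.
by rewrite !mxE (negbTE ji) andbF mulr0.
Qed.

Lemma enorm_le_sum k (x : 'rV[R]_k) : enorm x <= \sum_i `|x 0 i|.
Proof.
rewrite [X in enorm X](row_sum_delta x); apply: le_trans (enorm_sum _ _ _) _.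
by apply: ler_sum => i _; rewrite enormZ enorm_delta mulr1.
Qed.

(** Balls of row vectors are entrywise, hence the loss of a factor [k]; dividing by [k.+1] covers
    [k = 0]. *)
Lemma enorm_ball k (x : 'rV[R]_k) e : 0 < e ->
  exists2 d, 0 < d & forall y, ball x d y -> enorm (x - y) <= e.
Proof.
move=> e0; exists (e / k.+1%:R); first by rewrite divr_gt0 ?ltr0Sn.
move=> y xy; apply: le_trans (enorm_le_sum _) _.
apply: (@le_trans _ _ (\sum_(i < k) e / k.+1%:R)); last first.
  rewrite sumr_const card_ord -[_ *+ k]mulr_natr mulrAC.
  by rewrite ler_pdivrMr ?ltr0Sn // ler_pM2l // ler_nat.
apply: ler_sum => i _; rewrite !mxE; apply: ltW.
by have [_] := xy; apply.
Qed.

End Euclidean.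

(** * Step two groups and horizontal polygons *)

Section Group.
Context (R : realType) (m n2 : nat).
Context (B : 'rV[R]_m -> 'rV[R]_m -> 'rV[R]_n2) (B_skew : skew_bilinear B).
Local Notation G := (carnot_pt R m n2).
Implicit Types (x y z h : 'rV[R]_m) (p q r : G) (w : nat -> 'rV[R]_m).

Lemma skewB x y : B x y = - B y x.
Proof. by case: B_skew => _; apply. Qed.

Lemma skewDl x y z : B (x + y) z = B x z + B y z.
Proof. by case: B_skew => /(_ 1 x y z) + _; rewrite !scale1r. Qed.

Lemma skew0l z : B 0 z = 0.
Proof. by apply: (addrI (B 0 z)); rewrite -skewDl !addr0. Qed.

Lemma skewZl a x z : B (a *: x) z = a *: B x z.
Proof. by case: B_skew => /(_ a x 0 z) + _; rewrite skew0l !addr0. Qed.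

Lemma skewDr x y z : B z (x + y) = B z x + B z y.
Proof. by rewrite skewB skewDl opprD -!skewB. Qed.

Lemma skewZr a x z : B z (a *: x) = a *: B z x.
Proof. by rewrite skewB skewZl -scalerN -skewB. Qed.

Lemma skew0r z : B z 0 = 0.
Proof. by rewrite skewB skew0l oppr0. Qed.

Lemma skewNl x z : B (- x) z = - B x z.
Proof. by rewrite -scaleN1r skewZl scaleN1r. Qed.

Lemma skewNr x z : B z (- x) = - B z x.
Proof. by rewrite -scaleN1r skewZr scaleN1r. Qed.

Lemma skewxx x : B x x = 0.
Proof. by apply/rowP => i; have /rowP/(_ i) := skewB x x; rewrite !mxE; lra. Qed.

Definition skewE := (skewDl, skewDr, skewNl, skewNr, skewZl, skewZr, skewxx,
  skew0l, skew0r).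

Lemma skew_suml (I : Type) (s : seq I) (P : pred I) F z :
  B (\sum_(i <- s | P i) F i) z = \sum_(i <- s | P i) B (F i) z.
Proof.
by elim/big_rec2: _ => [|i y1 y2 _ <-]; rewrite ?skewDl ?skew0l.
Qed.

Lemma skew_sumr (I : Type) (s : seq I) (P : pred I) F z :
  B z (\sum_(i <- s | P i) F i) = \sum_(i <- s | P i) B z (F i).
Proof.
by elim/big_rec2: _ => [|i y1 y2 _ <-]; rewrite ?skewDr ?skew0r.
Qed.

Definition skew_bound : R :=
  \sum_(i < m) \sum_(j < m) enorm (B (delta_mx 0 i) (delta_mx 0 j)).

Lemma skew_bound_ge0 : 0 <= skew_bound.
Proof. by rewrite !sumr_ge0 // => i _; rewrite sumr_ge0 // => j _; apply: enorm_ge0. Qed.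

Lemma enorm_skew_le x y : enorm (B x y) <= skew_bound * (enorm x * enorm y).
Proof.
rewrite [in leLHS](row_sum_delta x) skew_suml mulr_suml.
apply: le_trans (enorm_sum _ _ _) _; apply: ler_sum => i _.
rewrite [in leLHS](row_sum_delta y) skew_sumr mulr_suml.
apply: le_trans (enorm_sum _ _ _) _; apply: ler_sum => j _.
rewrite skewZl skewZr !enormZ mulrA [leRHS]mulrC ler_wpM2r ?enorm_ge0 //.
by rewrite ler_pM ?coord_le_enorm.
Qed.

Local Notation "p ** q" := (gmul B p q) (at level 40, left associativity).
Local Notation inv := (@ginv R m n2).
Local Notation e := ((0, 0) : G).

Lemma gmulA p q r : p ** (q ** r) = p ** q ** r.
Proof.
case: p q r => [p1 p2] [q1 q2] [r1 r2]; rewrite /gmul /= !skewE; congr pair.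
  by rewrite addrA.
by apply/rowP => i; rewrite !mxE; ring.
Qed.

Lemma gmul0l p : e ** p = p.
Proof. by case: p => p1 p2; rewrite /gmul /= skew0l !add0r addr0. Qed.

Lemma gmul0r p : p ** e = p.
Proof. by case: p => p1 p2; rewrite /gmul /= skew0r !addr0. Qed.

Lemma gmulVl p : inv p ** p = e.
Proof. by case: p => p1 p2; rewrite /gmul /= skewNl skewxx oppr0 !addNr addr0. Qed.

Lemma gmulVr p : p ** inv p = e.
Proof. by case: p => p1 p2; rewrite /gmul /= skewNr skewxx oppr0 !subrr addr0. Qed.

Lemma ginvM p q : inv (p ** q) = inv q ** inv p.
Proof.
case: p q => [p1 p2] [q1 q2]; rewrite /gmul /ginv /= !skewE (skewB q1 p1).
by congr pair; apply/rowP => i; rewrite !mxE; ring.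
Qed.

Lemma ginvK p : inv (inv p) = p.
Proof. by case: p => p1 p2; rewrite /ginv /= !opprK. Qed.

Lemma ginv_hor h : inv (hor n2 h) = hor n2 (- h).
Proof. by rewrite /ginv /hor /= oppr0. Qed.

Fixpoint pth w n : G := if n is k.+1 then pth w k ** hor n2 (w k) else e.

Lemma pth1E w n : (pth w n).1 = \sum_(i < n) w i.
Proof. by elim: n => [|n IH]; rewrite ?big_ord0 // big_ord_recr /= IH. Qed.

Lemma pthD w n k : pth w (n + k) = pth w n ** pth (fun i => w (n + i)%N) k.
Proof.
elim: k => [|k IH]; first by rewrite addn0 /= gmul0r.
by rewrite addnS /= IH gmulA.
Qed.

Lemma eq_pth w w' n : (forall i, (i < n)%N -> w i = w' i) -> pth w n = pth w' n.
Proof.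
elim: n => //= n IH ww'; rewrite IH ?ww' // => i ilt.
by apply: ww'; apply: ltnW.
Qed.

Lemma pthS w n : pth w n.+1 = hor n2 (w 0%N) ** pth (fun i => w i.+1) n.
Proof. by rewrite -add1n pthD /= gmul0l. Qed.

Lemma pth_rev w n : pth (fun i => - w (n - i.+1)%N) n = inv (pth w n).
Proof.
elim: n => [|n IH]; first by rewrite /= /ginv /= !oppr0.
by rewrite pthS subn1 /= ginvM ginv_hor -IH.
Qed.

Definition plen w n : R := \sum_(i < n) enorm (w i).

Lemma plen_ge0 w n : 0 <= plen w n.
Proof. by rewrite sumr_ge0 // => i _; apply: enorm_ge0. Qed.

Definition pcat w n w' i := if (i < n)%N then w i else w' (i - n)%N.

Lemma pth_cat w n w' k : pth (pcat w n w') (n + k) = pth w n ** pth w' k.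
Proof.
rewrite pthD; congr (_ ** _); apply: eq_pth => i ilt; rewrite /pcat ?ilt //.
by rewrite ltnNge leq_addr /= addKn.
Qed.

Lemma plen_cat w n w' k : plen (pcat w n w') (n + k) = plen w n + plen w' k.
Proof.
rewrite /plen big_split_ord /=; congr (_ + _); apply: eq_bigr => i _; rewrite /pcat.
  by rewrite ltn_ord.
by rewrite ltnNge leq_addr /= addKn.
Qed.

Lemma plen_rev w n : plen (fun i => - w (n - i.+1)%N) n = plen w n.
Proof.
rewrite /plen (reindex_inj rev_ord_inj) /=; apply: eq_bigr => i _.
by rewrite subnSK // subKn ?enormN // ltnW.
Qed.

(** The distance from the identity measured by polygons alone; [ccdistE] identifies it with the
    Carnot-Caratheodory distance. As [inf] is 0 on the empty set, the definition is meaningful only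
    once [reach_chow] provides polygons. *)
Definition polydist p : R :=
  inf [set l | exists w n, pth w n = p /\ plen w n = l].
Local Notation D := polydist.

Lemma polydist_le w n : D (pth w n) <= plen w n.
Proof.
apply: ge_inf; last by exists w, n.
by exists 0 => _ [w' [n' [_ <-]]]; apply: plen_ge0.
Qed.

Lemma polydist_ge0 p : 0 <= D p.
Proof.
rewrite /polydist; set A := [set _ | _].
have [->|/set0P ne] := eqVneq A set0; first by rewrite inf0.
apply: lb_le_inf => // _ [w' [n' [_ <-]]]; exact: plen_ge0.
Qed.

Lemma polydist_hor h : D (hor n2 h) <= enorm h.
Proof.
have := polydist_le (fun=> h) 1.
by rewrite /plen big_ord1 /= gmul0l.
Qed.

Context (B_span : B_spanning B).

(* The commutator of [x] and [y] is the central element [2 B(x, y)]; rescaling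
   both sides by the square root of [a] produces any small central element by
   a short polygon. *)
Lemma pth_commutator (a : R) x y : exists w n,
  pth w n = (0, a *: B x y) /\ plen w n <= 2 * (enorm x + enorm y) * Num.sqrt `|a|.
Proof.
set s := Num.sqrt (`|a| / 2).
have s2 : s * s = `|a| / 2 by rewrite -expr2 sqr_sqrtr // divr_ge0.
(* The four edges end at twice [B] of the first two, whence the 1/2 inside [s]; the sign of [a] is
   carried by the edges along [y]. *)
exists (nth 0 [:: s *: x; (s * Num.sg a) *: y; - (s *: x); - ((s * Num.sg a) *: y)]), 4%N.
split.
  rewrite /= /gmul /hor /=; congr pair; first by apply/rowP => i; rewrite !mxE; ring.
  rewrite !skewE (skewB y x); apply/rowP => i; rewrite !mxE.
  have aE : a = 2 * (s * s * Num.sg a) by rewrite s2 {1}[a]numEsg; field.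
  by rewrite [in RHS]aE; ring.
have sle : s <= Num.sqrt `|a|.
  rewrite ler_sqrt // ler_pdivrMr //; have := normr_ge0 a; lra.
have sg1 : `|Num.sg a| <= 1 by rewrite normr_sg lern1 leq_b1.
have s0 : 0 <= s by apply: sqrtr_ge0.
rewrite /plen !big_ord_recr big_ord0 /= add0r !enormN !enormZ normrM (ger0_norm s0).
set sx := enorm x; set sy := enorm y.
have x0 : 0 <= sx by apply: enorm_ge0.
have y0 : 0 <= sy by apply: enorm_ge0.
have H : s * `|Num.sg a| * sy <= s * sy.
  by rewrite ler_wpM2r // ler_piMr.
have H2 : (sx + sy) * s <= (sx + sy) * Num.sqrt `|a| by rewrite ler_wpM2l // addr_ge0.
lra.
Qed.

Definition reach p l := exists w n, pth w n = p /\ plen w n <= l.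

Lemma reachM p q l k : reach p l -> reach q k -> reach (p ** q) (l + k).
Proof.
move=> [w [n [<- wl]]] [v [j [<- vl]]]; exists (pcat w n v), (n + j)%N.
by rewrite pth_cat plen_cat lerD.
Qed.

Lemma reach_central_sum (I : Type) (s : seq I) (F : I -> 'rV[R]_n2) (L : I -> R) :
  (forall i, reach (0, F i) (L i)) ->
  reach (0, \sum_(i <- s) F i) (\sum_(i <- s) L i).
Proof.
move=> FL; elim: s => [|i s IH].
  by rewrite !big_nil; exists (fun=> 0), 0%N; rewrite /plen big_ord0.
rewrite !big_cons; have := reachM (FL i) IH.
by rewrite /gmul /= skewxx !addr0.
Qed.

Lemma reach_axis (j : 'I_n2) : exists2 C, 0 <= C &
  forall a, reach (0, a *: delta_mx 0 j) (C * Num.sqrt `|a|).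
Proof.
have [k [xs [ys ->]]] := B_span (delta_mx 0 j).
exists (\sum_(i < k) 2 * (enorm (xs i) + enorm (ys i))).
  by rewrite sumr_ge0 // => i _; rewrite mulr_ge0 ?addr_ge0 ?enorm_ge0.
move=> a; rewrite scaler_sumr mulr_suml; apply: reach_central_sum => i.
exact: pth_commutator.
Qed.

(** Quantitative Chow theorem: one horizontal edge reaches [p.1], then commutators correct the
    second layer coordinate by coordinate. The square root is the degree-two scaling of that
    layer. *)
Lemma reach_chow : exists2 C, 0 <= C &
  forall p, reach p (enorm p.1 + C * Num.sqrt (enorm p.2)).
Proof.
have [C C0 CP] : exists2 C : 'I_n2 -> R, forall j, 0 <= C j &
  forall j a, reach (0, a *: delta_mx 0 j) (C j * Num.sqrt `|a|).
  have /choice[C CP] : forall j : 'I_n2, exists C : R, 0 <= C /\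
      forall a, reach (0, a *: delta_mx 0 j) (C * Num.sqrt `|a|).
    by move=> j; have [C ? ?] := reach_axis j; exists C.
  by exists C => j; case: (CP j).
exists (\sum_j C j); first by rewrite sumr_ge0.
case=> p1 p2 /=.
have -> : (p1, p2) = hor n2 p1 ** (0, p2) by rewrite /gmul /= skew0r addr0 add0r addr0.
apply: reachM.
  by exists (fun=> p1), 1%N; rewrite /plen big_ord1 /= gmul0l.
have [w [n [E l]]] : reach (0, p2) (\sum_j C j * Num.sqrt `|p2 0 j|).
  by rewrite [in (0, p2)](row_sum_delta p2); apply: reach_central_sum.
exists w, n; split=> //; apply: le_trans l _.
rewrite mulr_suml; apply: ler_sum => j _; rewrite ler_wpM2l //.
by rewrite ler_sqrt ?enorm_ge0 // coord_le_enorm.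
Qed.

Lemma polydist_lt p l : D p < l -> exists w n, pth w n = p /\ plen w n < l.
Proof.
have [C _ /(_ p) [w [n [E _]]]] := reach_chow.
move=> Dl; have [|_ [v [k [Ev <-]]] vl] :=
  @inf_lt R [set l | exists w n, pth w n = p /\ plen w n = l] l _ Dl.
  by exists (plen w n), w, n.
by exists v, k.
Qed.

Lemma polydistM p q : D (p ** q) <= D p + D q.
Proof.
apply/ler_addgt0Pr => eps e0.
have [w [n [<- wl]]] : exists w n, pth w n = p /\ plen w n < D p + eps / 2.
  by apply: polydist_lt; rewrite ltrDl divr_gt0.
have [v [k [<- vl]]] : exists w n, pth w n = q /\ plen w n < D q + eps / 2.
  by apply: polydist_lt; rewrite ltrDl divr_gt0.
rewrite -pth_cat; apply: le_trans (polydist_le _ _) _; rewrite plen_cat; lra.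
Qed.

Lemma polydistV p : D (inv p) = D p.
Proof.
suff H q : D (inv q) <= D q by apply/eqP; rewrite eq_le H -{1}(ginvK p) H.
apply/ler_addgt0Pr => eps e0.
have [w [n [<- wl]]] : exists w n, pth w n = q /\ plen w n < D q + eps.
  by apply: polydist_lt; rewrite ltrDl.
by rewrite -pth_rev; apply: le_trans (polydist_le _ _) _; rewrite plen_rev ltW.
Qed.

Lemma polydist_small theta : 0 < theta -> exists2 d, 0 < d &
  forall p, enorm p.1 <= d -> enorm p.2 <= d -> D p <= theta.
Proof.
move=> t0; have [C C0 H] := reach_chow.
set s := theta / (2 * (C + 1)).
have C1 : 0 < C + 1 by lra.
have s0 : 0 < s by rewrite divr_gt0 // mulr_gt0.
exists (Num.min (theta / 2) (s ^+ 2)).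
  by rewrite lt_min divr_gt0 //= exprn_gt0.
move=> p; rewrite !le_min => /andP[p1 _] /andP[_ p2].
have [w [n [E wl]]] := H p; rewrite -{}E; apply: le_trans (polydist_le _ _) _.
apply: le_trans {w n} wl _.
have : Num.sqrt (enorm p.2) <= s.
  by rewrite (le_trans (ler_wsqrtr p2)) // sqrtr_sqr ger0_norm // ltW.
have : s * (C + 1) = theta / 2 by rewrite /s; field; lra.
have := sqrtr_ge0 (enorm p.2).
set r := Num.sqrt _ => r0 sE rs.
have Crs : C * r <= C * s by rewrite ler_wpM2l.
clearbody s r; lra.
Qed.

(** The second layer of [q^-1 p] contains [B (p.1 - q.1) p.1], so the admissible Euclidean radius
    shrinks with the size of [p.1]. *)
Lemma polydist_continuous p theta : 0 < theta -> exists2 d, 0 < d &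
  forall q, enorm (p.1 - q.1) <= d -> enorm (p.2 - q.2) <= d ->
    D (inv q ** p) <= theta.
Proof.
move=> t0; have [d d0 H] := polydist_small t0.
set c := 1 + skew_bound * enorm p.1.
have c0 : 1 <= c by rewrite lerDl mulr_ge0 ?enorm_ge0 ?skew_bound_ge0.
have cp : 0 < c by lra.
exists (d / c); first by rewrite divr_gt0.
move=> q pq1 pq2; apply: H => /=.
  by rewrite addrC (le_trans pq1) // ler_pdivrMr // ler_peMr // ltW.
have -> : - q.2 + p.2 + B (- q.1) p.1 = (p.2 - q.2) + B (p.1 - q.1) p.1.
  by rewrite skewDl skewxx add0r (addrC (- q.2)).
apply: le_trans (enormD _ _) _.
have h1 : enorm (B (p.1 - q.1) p.1) <= skew_bound * (d / c * enorm p.1).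
  apply: le_trans (enorm_skew_le _ _) _.
  by rewrite ler_wpM2l ?skew_bound_ge0 // ler_wpM2r ?enorm_ge0.
have h2 : d / c + skew_bound * (d / c * enorm p.1) = d.
  transitivity (d / c * c); first by rewrite {4}/c; ring.
  by rewrite divfK // gt_eqF.
lra.
Qed.

End Group.

(** * Weights for orthogonal recurrences *)

Section OrthogonalRecurrence.
Context (R : realType).

Lemma coef_prod_linear_le (I : Type) (s : seq I) (a b : I -> R) :
  (forall i, `|a i| <= 1) -> (forall i, `|b i| <= 1) ->
  forall k, `|(\prod_(i <- s) (a i *: 'X - (b i)%:P))`_k| <= 2 ^+ size s.
Proof.
move=> a1 b1; elim: s => [|i s IH] k.
  by rewrite big_nil coef1 normr_nat expr0 lern1 leq_b1.
rewrite big_cons mulrBl -scalerAl coefB coefZ coefXM coefCM /= exprS.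
apply: le_trans (ler_normB _ _) _; rewrite mulr_natl mulr2n lerD // normrM.
  rewrite -[leRHS]mul1r ler_pM //; case: ifP => // _.
  by rewrite normr0 exprn_ge0.
by rewrite -[leRHS]mul1r ler_pM.
Qed.

(** Leibniz expansion: [m!] products of [m] linear factors with coefficients at most 1. The bound is
    crude, but it does not depend on [A]. *)
Lemma char_poly_coef_le m (A : 'M[R]_m) : (forall i j, `|A i j| <= 1) ->
  forall k, `|(char_poly A)`_k| <= m`!%:R * 2 ^+ m.
Proof.
move=> A1 k; rewrite /char_poly /determinant coef_sum.
apply: le_trans (ler_norm_sum _ _ _) _.
rewrite mulr_natl -card_Sn -sumr_const; apply: ler_sum => s _.
have sz : size (index_enum 'I_m) = m by rewrite [index_enum _]unlock -enumT size_enum_ord.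
have H : `|(\prod_i char_poly_mx A i (s i))`_k| <= 2 ^+ m.
  rewrite (eq_bigr (fun i => ((i == s i)%:R : R) *: 'X - (A i (s i))%:P)); last first.
    by move=> i _; rewrite !mxE scaler_nat.
  rewrite -[in leRHS]sz.
  by apply: coef_prod_linear_le => i //; rewrite normr_nat lern1 leq_b1.
by rewrite -signr_odd; case: (odd s); rewrite ?expr1 ?expr0 ?mulN1r ?mul1r ?coefN ?normrN.
Qed.

Context (m : nat).
Notation m1 := m.+1.
Implicit Types A : 'M[R]_m1.

Definition preserves_enorm A := forall x : 'rV[R]_m1, enorm (x *m A) = enorm x.

Lemma preserves_enormX A k : preserves_enorm A -> preserves_enorm (A ^+ k).
Proof.
move=> AI x; elim: k => [|k IH]; first by rewrite expr0 mulmx1.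
by rewrite exprSr mulmxA AI.
Qed.

Lemma preserves_enorm_coef_le A : preserves_enorm A -> forall i j, `|A i j| <= 1.
Proof.
move=> AI i j; rewrite -(enorm_delta R i) -AI -rowE.
by apply: le_trans (coord_le_enorm _ j); rewrite mxE.
Qed.

(* The characteristic polynomial of [A ^+ k] kills the [k]-step increments of a
   sequence whose increments are [v *m A ^+ j]; the factor [X - 1] turns this
   into a relation on the sequence itself, with coefficients bounded
   independently of [A] and [k]. *)
Definition annihilator A : {poly R} := char_poly A * ('X - 1%:P).

Definition annihilator_bound : R := 2 * (m1`!%:R * 2 ^+ m1).

Lemma annihilator_bound_ge0 : 0 <= annihilator_bound.
Proof. by rewrite !mulr_ge0 ?exprn_ge0. Qed.

Lemma annihilatorE A l :
  (annihilator A)`_l = (if l is l'.+1 then (char_poly A)`_l' else 0) - (char_poly A)`_l.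
Proof. by rewrite /annihilator mulrBr mulr1 coefB coefMX; case: l. Qed.

Lemma annihilator_lead A : (annihilator A)`_m.+2 = 1.
Proof.
rewrite annihilatorE [X in _ - X]nth_default ?size_char_poly // subr0.
by have /eqP := char_poly_monic A; rewrite /lead_coef size_char_poly.
Qed.

(** The factor [X - 1] makes 1 a root, and the leading coefficient is 1. The opposites of the lower
    coefficients are therefore weights of total mass one. *)
Lemma annihilator_sum A : \sum_(l < m.+2) (annihilator A)`_l = -1.
Proof.
have : (annihilator A).[1] = 0 by rewrite /annihilator hornerM !hornerE subrr mulr0.
rewrite (@horner_coef_wide _ m.+3); last first.
  rewrite /annihilator size_Mmonic ?monicXsubC ?monic_neq0 ?char_poly_monic //.
  by rewrite size_char_poly size_XsubC addn2.
rewrite big_ord_recr /= annihilator_lead expr1n mulr1 => /eqP; rewrite addr_eq0 => /eqP <-.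
by apply: eq_bigr => i _; rewrite expr1n mulr1.
Qed.

Lemma annihilator_le A : preserves_enorm A -> forall l, `|(annihilator A)`_l| <= annihilator_bound.
Proof.
move=> /preserves_enorm_coef_le /char_poly_coef_le AI l; rewrite annihilatorE.
apply: le_trans (ler_normB _ _) _; rewrite /annihilator_bound mulr_natl mulr2n.
by rewrite lerD //; case: l => [|l] //; rewrite normr0 mulr_ge0 ?exprn_ge0.
Qed.

Lemma horner_mxE A (p : {poly R}) : horner_mx A p = \sum_(l < size p) p`_l *: A ^+ l.
Proof.
rewrite -[in LHS](coefK p) poly_def linear_sum; apply: eq_bigr => l _ /=.
by rewrite linearZ /= rmorphXn /= horner_mx_X.
Qed.

Section Stride.
Context A (v : 'rV[R]_m1) (Z : nat -> 'rV[R]_m1).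
Hypothesis ZS : forall j, Z j.+1 = Z j + v *m A ^+ j.

Let stepE k j : Z (j + k)%N = Z j + (v *m \sum_(i < k) A ^+ i) *m A ^+ j.
Proof.
elim: k => [|k IH]; first by rewrite addn0 big_ord0 mulmx0 mul0mx addr0.
rewrite addnS ZS IH big_ord_recr /= mulmxDr mulmxDl addrA; congr (_ + _).
by rewrite -mulmxA -[A ^+ k *m _]/(A ^+ k * A ^+ j) -exprD addnC.
Qed.

(** Summation by parts moves [X - 1] onto [Z]. The [k]-step differences are a fixed vector times the
    powers of [A ^+ k], so Cayley-Hamilton makes their combination vanish. *)
Lemma annihilator_stride k j :
  \sum_(l < m.+3) (annihilator (A ^+ k))`_l *: Z (j + l * k)%N = 0.
Proof.
set c := char_poly (A ^+ k).
rewrite (eq_bigr (fun l : 'I_m.+3 => (if l : nat is l'.+1 then c`_l' else 0) *: Z (j + l * k)%N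
    - c`_l *: Z (j + l * k)%N)); last by move=> l _; rewrite annihilatorE scalerBl.
rewrite sumrB big_ord_recl /= scale0r add0r [X in _ - X]big_ord_recr /=.
rewrite [c`_m.+2]nth_default ?size_char_poly // scale0r addr0 -sumrB.
set d := v *m \sum_(i < k) A ^+ i.
rewrite (eq_bigr (fun l : 'I_m.+2 => d *m A ^+ j *m (c`_l *: (A ^+ k) ^+ l))); last first.
  move=> l _; rewrite -scalerBr /bump /= add1n mulSn addnA addnAC stepE -/d.
  rewrite [_ + d *m _]addrC addrK -scalemxAr -[in RHS](mulmxA d); congr (_ *: (_ *m _)).
  by rewrite -[RHS]/(_ * _) -exprM -exprD mulnC.
rewrite -mulmx_sumr; suff -> : \sum_(l < m.+2) c`_l *: (A ^+ k) ^+ l = 0 by rewrite mulmx0.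
by have := Cayley_Hamilton (A ^+ k); rewrite -/c horner_mxE size_char_poly.
Qed.

Lemma stride_target k j :
  Z (j + m.+2 * k)%N = \sum_(l < m.+2) (- (annihilator (A ^+ k))`_l) *: Z (j + l * k)%N.
Proof.
have := annihilator_stride k j; rewrite big_ord_recr /= annihilator_lead scale1r.
move/eqP; rewrite addrC addr_eq0 => /eqP ->; rewrite -sumrN.
by apply: eq_bigr => l _; rewrite scaleNr.
Qed.

(* The relation of a single stride [k] charges only a few terms of the
   sequence; averaging the relations over [k = 1, ..., M] spreads the weights so
   that each is O(1/M). *)
Lemma averaged_weights M : preserves_enorm A -> (0 < M)%N ->
  exists phi : nat -> R,
  [/\ \sum_(i < m.+2 * M) phi i = 1,
      \sum_(i < m.+2 * M) phi i *: Z i = Z (m.+2 * M)%N &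
      forall i, `|phi i| <= m.+2%:R * annihilator_bound / M%:R].
Proof.
move=> AI M0; set T := (m.+2 * M)%N.
(* Here the stride is [k.+1]. Indices are counted backwards from [T], so that the relations of all
   strides express the same term [Z T]. *)
pose idx (k l : nat) := (T - (m.+2 - l) * k.+1)%N.
pose b (k l : nat) := - (annihilator (A ^+ k.+1))`_l.
pose phi (i : nat) := M%:R^-1 * \sum_(k < M) \sum_(l < m.+2) b k l * (idx k l == i)%:R.
have M0R : (M%:R : R) != 0 by rewrite pnatr_eq0 -lt0n.
have le_T k l : (k < M)%N -> ((m.+2 - l) * k.+1 <= T)%N.
  by move=> kM; rewrite leq_mul // leq_subr.
have idx_lt k l : (k < M)%N -> (l < m.+2)%N -> (idx k l < T)%N.
  by move=> kM lm; rewrite ltn_subrL muln_gt0 subn_gt0 lm muln_gt0.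
have phiE (V : lmodType R) (f : nat -> V) : \sum_(i < T) phi i *: f i =
    M%:R^-1 *: \sum_(k < M) \sum_(l < m.+2) b k l *: f (idx k l).
  under eq_bigr do rewrite /phi -scalerA scaler_suml.
  rewrite -scaler_sumr exchange_big; congr (_ *: _); apply: eq_bigr => k _ /=.
  under eq_bigr do rewrite scaler_suml.
  rewrite exchange_big; apply: eq_bigr => l _ /=.
  rewrite (bigD1 (Ordinal (idx_lt k l (ltn_ord k) (ltn_ord l)))) //= eqxx mulr1.
  rewrite big1 ?addr0 // => i ine; case: eqP => [E|_]; last by rewrite mulr0 scale0r.
  by case/eqP: ine; apply: val_inj; rewrite /= E.
exists phi; split.
- have := phiE R^o (fun=> 1); rewrite /GRing.scale /=.
  under eq_bigr do rewrite mulr1; move=> ->.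
  rewrite (eq_bigr (fun=> 1)); last first.
    move=> k _; under eq_bigr do rewrite mulr1.
    by rewrite sumrN annihilator_sum opprK.
  by rewrite sumr_const card_ord mulVf.
- rewrite phiE (eq_bigr (fun=> Z T)); last first.
    move=> k _; rewrite -(@subnK (m.+2 * k.+1) T) ?leq_mul // stride_target.
    apply: eq_bigr => l _; congr (_ *: Z _).
    rewrite /idx mulnBl subnBA ?leq_mul2r ?(ltnW (ltn_ord l)) ?orbT //.
    by rewrite addnC -addnBA ?leq_mul // addnC.
  by rewrite sumr_const card_ord -(scaler_nat M (Z T)) scalerA mulVf // scale1r.
- move=> i; rewrite /phi normrM normrV ?unitfE // normr_nat mulrC ler_wpM2r ?invr_ge0 //.
  apply: le_trans (ler_norm_sum _ _ _) _.
  apply: (@le_trans _ _ (\sum_(k < M) \sum_(l < m.+2) annihilator_bound * (idx k l == i)%:R)).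
    apply: ler_sum => k _; apply: le_trans (ler_norm_sum _ _ _) _.
    apply: ler_sum => l _; rewrite normrM normr_nat ler_wpM2r // normrN.
    by apply: annihilator_le; apply: preserves_enormX.
  (* For fixed [l] distinct strides hit distinct indices, so each [i] is charged at most once for
     each of the [m.+2] values of [l]. *)
  rewrite exchange_big /= mulr_natl -[in leRHS](card_ord m.+2) -sumr_const.
  apply: ler_sum => l _; rewrite -mulr_sumr ler_piMr ?annihilator_bound_ge0 //.
  have idx_inj (k k' : 'I_M) : idx k l = idx k' l -> k = k'.
    move/(congr1 (subn T)); rewrite !subKn ?le_T // => /eqP.
    by rewrite eqn_pmul2l ?subn_gt0 // => /eqP[/val_inj].
  have [k0 k0E|none] := pickP (fun k : 'I_M => idx k l == i); last first.
    by rewrite big1 // => k _; rewrite none.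
  rewrite (bigD1 k0) //= k0E big1 ?addr0 // => k kk0.
  case: eqP => // /esym; rewrite -(eqP k0E) => /idx_inj /esym/eqP.
  by rewrite (negbTE kk0).
Qed.

End Stride.
End OrthogonalRecurrence.

(** * Penalised energy of polygons *)

Section Minimizer.
Context (R : realType) (m n2 : nat).
Context (B : 'rV[R]_m -> 'rV[R]_m -> 'rV[R]_n2) (B_skew : skew_bilinear B).
Local Notation G := (carnot_pt R m n2).
Implicit Types (p : G) (w : nat -> 'rV[R]_m).
Local Notation pth := (pth B).

(** All edges move along the same [h], so [B h h = 0] removes the quadratic terms and the expansion
    is exact. The vector [2 *: (pth w j).1 + w j] is twice the midpoint of edge [j]; [- (pth w n).1]
    comes from the earlier perturbations acting on later edges. *)
Lemma pth_perturb w (phi : nat -> R) h n :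
  pth (fun i => w i + phi i *: h) n =
  ((pth w n).1 + (\sum_(i < n) phi i) *: h,
   (pth w n).2 +
   B (\sum_(j < n) phi j *: (2 *: (pth w j).1 + w j - (pth w n).1)) h).
Proof.
elim: n => [|n IH] /=; first by rewrite !big_ord0 scale0r (skew0l B_skew) !addr0.
rewrite IH {IH} /gmul /=; set E1 := (pth w n).1; set E2 := (pth w n).2.
set F := \sum_(i < n) phi i.
have -> : \sum_(j < n.+1) phi j *: (2 *: (pth w j).1 + w j - (E1 + w n)) =
    \sum_(j < n) phi j *: (2 *: (pth w j).1 + w j - E1) - F *: w n + phi n *: E1.
  rewrite big_ord_recr /= -/E1; congr (_ + _); last first.
    by congr (_ *: _); rewrite opprD addrACA subrr addr0 scaler_nat mulr2n addrK.
  rewrite /F scaler_suml -sumrB; apply: eq_bigr => j _.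
  by rewrite -scalerBr opprD !addrA.
rewrite big_ord_recr /= -/F; congr pair.
  by rewrite scalerDl addrACA.
rewrite !(skewE B_skew) (skewB B_skew h (w n)).
by apply/rowP => i; rewrite !mxE; ring.
Qed.

(* Penalising the endpoint instead of prescribing it makes the Euler-Lagrange
   equation hold with an explicit multiplier, so that abnormal minimisers play
   no role. *)
Definition energy (K : R) p N w : R :=
  N%:R * (\sum_(i < N) dotp (w i) (w i)) +
  K * (dotp ((pth w N).1 - p.1) ((pth w N).1 - p.1) +
       dotp ((pth w N).2 - p.2) ((pth w N).2 - p.2)).

Section Continuity.
Context (T : topologicalType).

Definition ccont k (f : T -> 'rV[R]_k) := forall i, continuous (fun t => f t 0 i).

Lemma continuous_add (f g : T -> R) :
  continuous f -> continuous g -> continuous (fun t => f t + g t).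
Proof. by move=> fc gc t; apply: (@continuousD R R^o); [exact: fc | exact: gc]. Qed.

Lemma continuous_mul (f g : T -> R) :
  continuous f -> continuous g -> continuous (fun t => f t * g t).
Proof. by move=> fc gc t; apply: continuousM; [exact: fc | exact: gc]. Qed.

Lemma continuous_const (c : R) : continuous (fun _ : T => c).
Proof. by move=> t; apply: cvg_cst. Qed.

Lemma continuous_sum (I : Type) (s : seq I) (f : I -> T -> R) :
  (forall i, continuous (f i)) -> continuous (fun t => \sum_(i <- s) f i t).
Proof.
move=> fc; elim: s => [|i s IH].
  by under eq_fun do rewrite big_nil; apply: continuous_const.
by under eq_fun do rewrite big_cons; apply: continuous_add.
Qed.

Lemma ccontD k (f g : T -> 'rV[R]_k) :
  ccont f -> ccont g -> ccont (fun t => f t + g t).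
Proof.
move=> fc gc i; under eq_fun do rewrite mxE.
exact: continuous_add.
Qed.

Lemma ccont_cst k (v : 'rV[R]_k) : ccont (fun=> v).
Proof. by move=> i; apply: continuous_const. Qed.

Lemma ccont_dotp k (f g : T -> 'rV[R]_k) :
  ccont f -> ccont g -> continuous (fun t => dotp (f t) (g t)).
Proof.
move=> fc gc; by apply: continuous_sum => i; apply: continuous_mul.
Qed.

Lemma ccont_skew (f g : T -> 'rV[R]_m) :
  ccont f -> ccont g -> ccont (fun t => B (f t) (g t)).
Proof.
move=> fc gc k.
rewrite (_ : (fun t => _) = (fun t => \sum_i \sum_j
    f t 0 i * (g t 0 j * B (delta_mx 0 i) (delta_mx 0 j) 0 k))).
  apply: continuous_sum => i; apply: continuous_sum => j.
  by do 2?[apply: continuous_mul => //]; apply: continuous_const.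
apply/funext => t; rewrite [in LHS](row_sum_delta (f t)) (skew_suml B_skew) summxE.
apply: eq_bigr => i _; rewrite [in LHS](row_sum_delta (g t)) (skew_sumr B_skew) summxE.
by apply: eq_bigr => j _; rewrite !(skewE B_skew) !mxE.
Qed.

Lemma energy_continuous K p N (w : T -> nat -> 'rV[R]_m) :
  (forall i, ccont (fun t => w t i)) -> continuous (fun t => energy K p N (w t)).
Proof.
move=> wc.
have pc : forall n, ccont (fun t => (pth (w t) n).1) /\ ccont (fun t => (pth (w t) n).2).
  elim=> [|n [c1 c2]]; first by split; apply: ccont_cst.
  split => /=; first exact: ccontD.
  by apply: ccontD; [apply: ccontD => //; apply: ccont_cst | apply: ccont_skew].
have dc k (f : T -> 'rV[R]_k) v : ccont f -> continuous (fun t => dotp (f t - v) (f t - v)).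
  by move=> fc; apply: ccont_dotp; apply: ccontD => //; apply: ccont_cst.
apply: continuous_add; apply: continuous_mul; try exact: continuous_const.
  by apply: continuous_sum => i; apply: ccont_dotp.
by apply: continuous_add; apply: dc; case: (pc N).
Qed.

End Continuity.

Lemma energy_ge K p N w i : 0 <= K -> (i < N)%N -> dotp (w i) (w i) <= energy K p N w.
Proof.
move=> K0 iN; rewrite /energy.
have d0 : 0 <= dotp (w i) (w i) by exact: dotp_ge0.
apply: (@le_trans _ _ (N%:R * \sum_(i < N) dotp (w i) (w i))); last first.
  by rewrite lerDl mulr_ge0 // addr_ge0 ?dotp_ge0.
apply: (@le_trans _ _ (\sum_(i < N) dotp (w i) (w i))).
  rewrite (bigD1 (Ordinal iN)) //= lerDl sumr_ge0 // => j _; exact: dotp_ge0.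
by rewrite ler_peMl ?sumr_ge0 ?ler1n ?(leq_ltn_trans _ iN) // => j _; exact: dotp_ge0.
Qed.

Lemma energy_min K p N : 0 <= K -> (0 < N)%N ->
  exists w, forall w', energy K p N w <= energy K p N w'.
Proof.
case: N => // T K0 _; set N := T.+1.
pose wv (v : 'rV[R]_(N * m)) (i : nat) : 'rV[R]_m :=
  \row_j v 0 (mxvec_index (inord i : 'I_N) j).
have cw : continuous (fun v => energy K p N (wv v)).
  apply: energy_continuous => i j; under eq_fun do rewrite mxE.
  exact: coord_continuous.
(* Outside the box some entry exceeds [M] in absolute value, and since [M >= 1] its square, hence
   the energy, exceeds the value at the zero polygon. The minimum over the box is thus global. *)
set M := energy K p N (fun=> 0) + 1.
have M1 : 1 <= M.
  rewrite lerDr; apply: le_trans (energy_ge p (fun=> 0) K0 (ltn0Sn T)).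
  exact: dotp_ge0.
pose A := [set v : 'rV[R]_(N * m) | forall i, v ord0 i \in `[(- M), M]].
have cA : compact A.
  apply: (@rV_compact _  _ (fun=> `[(- M), M]%classic)) => _; exact: segment_compact.
have A0 : A 0 by move=> i; rewrite mxE in_itv /=; lra.
have [v vA vmin] : exists2 v, v \in A & forall v', v' \in A ->
    energy K p N (wv v) <= energy K p N (wv v').
  apply: EVT_min_rV => //; first by exists 0.
  exact: continuous_subspaceT.
exists (wv v) => w.
pose u : 'rV[R]_(N * m) := mxvec (\matrix_(i < N, j < m) w i 0 j).
have wu i : (i < N)%N -> wv u i = w i.
  by move=> iN; apply/rowP => j; rewrite mxE mxvecE mxE inordK.
have -> : energy K p N w = energy K p N (wv u).
  rewrite /energy (eq_pth _ (w := wv u) (w' := w)) //.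
  by under [in RHS]eq_bigr => i _ do rewrite wu ?ltn_ord //.
have [uA|uA] := boolP (u \in A); first exact: vmin.
have v0 : energy K p N (wv v) <= energy K p N (fun=> 0).
  have := vmin 0; rewrite inE => /(_ A0); congr (_ <= energy _ _ _ _).
  by apply/funext => i; apply/rowP => j; rewrite !mxE.
apply: le_trans v0 _; have /existsNP[k] : ~ A u by move=> uA'; move/negP: uA; apply; rewrite inE.
case/mxvec_indexP: k => i j; rewrite mxvecE mxE in_itv /= -ler_norml => /negP; rewrite -ltNge => Mw.
rewrite (_ : w i = wv u i) in Mw; last by rewrite wu.
apply: le_trans (energy_ge p (wv u) K0 (ltn_ord i)).
rewrite -enorm2E; have := coord_le_enorm (wv u i) j; set e := enorm _ => eM.
have : M < e by apply: lt_le_trans eM.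
rewrite /M in M1 *; nra.
Qed.

(** By [pth_perturb], moving one edge by [s *: v] changes the energy by exactly [2 a s + b s^2],
    where [a] is the left-hand side. Nonnegativity for every [s] forces [a = 0]. *)
Lemma energy_critical K p N w : (forall w', energy K p N w <= energy K p N w') ->
  forall i v, (i < N)%N ->
  N%:R * dotp (w i) v + K * (dotp ((pth w N).1 - p.1) v +
    dotp ((pth w N).2 - p.2) (B (2 *: (pth w i).1 + w i - (pth w N).1) v)) = 0.
Proof.
move=> wmin i v iN; set y := 2 *: _ + _ - _; set a := (X in X = 0).
pose b := N%:R * dotp v v + K * (dotp v v + dotp (B y v) (B y v)).
have H s : 0 <= s * (2 * a) + s ^+ 2 * b.
  pose phi (j : nat) : R := if j == i then s else 0.
  have phi_sum (V : lmodType R) (f : nat -> V) : \sum_(j < N) phi j *: f j = s *: f i.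
    rewrite (bigD1 (Ordinal iN)) //= /phi eqxx big1 ?addr0 // => j ji.
    by case: eqP => [E|_]; [case/eqP: ji; apply: val_inj | rewrite scale0r].
  have phi1 : \sum_(j < N) phi j = s.
    have := phi_sum R^o (fun=> 1); rewrite /GRing.scale /= mulr1 => <-.
    by apply: eq_bigr => j _; rewrite mulr1.
  have := wmin (fun j => w j + phi j *: v); rewrite /energy pth_perturb /=.
  rewrite phi1 (phi_sum 'rV[R]_m (fun j => 2 *: (pth w j).1 + w j - (pth w N).1)) -/y.
  rewrite (skewZl B_skew).
  have -> : \sum_(j < N) dotp (w j + phi j *: v) (w j + phi j *: v) =
      \sum_(j < N) dotp (w j) (w j) + (2 * s * dotp (w i) v + s ^+ 2 * dotp v v).
    have := phi_sum R^o (fun j => 2 * dotp (w j) v + phi j * dotp v v).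
    rewrite {3}/phi eqxx /GRing.scale /= => E.
    transitivity (\sum_(j < N) dotp (w j) (w j) +
        s * (2 * dotp (w i) v + s * dotp v v)); last by ring.
    rewrite -E -big_split; apply: eq_bigr => j _ /=.
    by rewrite dotpDl !dotpDr !(dotpZl, dotpZr) (dotpC v); ring.
  rewrite !(addrAC _ _ (- _)).
  set e1 := (pth w N).1 - p.1; set e2 := (pth w N).2 - p.2.
  rewrite /a /b -/e1 -/e2; clearbody e1 e2 y.
  rewrite !(dotpDl, dotpDr, dotpZl, dotpZr) (dotpC v e1) (dotpC (B y v) e2).
  set S := \sum_(j < N) _.
  set d1 := dotp e1 e1; set d2 := dotp e2 e2; set d3 := dotp (w i) v; set d4 := dotp v v.
  set d5 := dotp e1 v; set d6 := dotp e2 _; set d7 := dotp (B y v) _.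
  rewrite -subr_ge0 => h; apply: le_trans h _; rewrite le_eqVlt; apply/orP; left; apply/eqP.
  by ring.
have [//|a0] := eqVneq a 0.
have c0 : 0 < `|b| + 1 by rewrite ltr_wpDl.
have := H (- a / (`|b| + 1)).
have -> : - a / (`|b| + 1) * (2 * a) + (- a / (`|b| + 1)) ^+ 2 * b =
   (a / (`|b| + 1)) ^+ 2 * (b - 2 * (`|b| + 1)) by field; lra.
have sq : 0 < (a / (`|b| + 1)) ^+ 2.
  by rewrite exprn_even_gt0 //= mulf_neq0 // invr_neq0 // gt_eqF.
rewrite pmulr_rge0 //; have := ler_norm b; have := normr_ge0 b; lra.
Qed.

(** Discrete substitute for a curve of length [L] from the identity to [p], run at constant speed.
    Chords telescope exactly in the first layer; in the second, each of the N arcs loses O(1/N^2),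
    hence the tolerance [C / N]. *)
Definition almost_reached p (L : R) := exists2 C, 0 <= C &
  forall N, (0 < N)%N -> exists w,
    [/\ forall i, (i < N)%N -> enorm (w i) <= L / N%:R,
        (pth w N).1 = p.1 & enorm ((pth w N).2 - p.2) <= C / N%:R].

End Minimizer.

(** * Cayley transforms and the structure of energy minimisers *)

Section SquaredDistance.
Context (R : realType) (m n2 : nat).
Context (B : 'rV[R]_m.+1 -> 'rV[R]_m.+1 -> 'rV[R]_n2).
Context (B_skew : skew_bilinear B).
Local Notation G := (carnot_pt R m.+1 n2).
Implicit Types (p : G) (w : nat -> 'rV[R]_m.+1) (x y v h : 'rV[R]_m.+1).
Local Notation pth := (pth B).
Local Notation energy := (energy B).
Local Notation D := (polydist B).

(** Up to normalisation, the skew operator usually written J_l on the first layer of a step two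
    group. *)
Definition bracket_mx (l : 'rV[R]_n2) : 'M[R]_m.+1 :=
  \matrix_(a, b) dotp l (B (delta_mx 0 a) (delta_mx 0 b)).

Lemma dotp_bracket_mx l x v : dotp (x *m bracket_mx l) v = dotp l (B x v).
Proof.
have dotp_sumr k (I : finType) (y : 'rV[R]_k) (F : I -> 'rV[R]_k) :
    dotp y (\sum_i F i) = \sum_i dotp y (F i).
  by elim/big_rec2: _ => [|i a b _ <-]; rewrite ?dotpDr // dotpC dotp0l.
rewrite [in RHS](row_sum_delta x) (skew_suml B_skew) dotp_sumr.
rewrite /dotp; under eq_bigr do rewrite mxE mulr_suml.
rewrite exchange_big; apply: eq_bigr => a _ /=; rewrite -/(dotp _ _).
rewrite [in RHS](row_sum_delta v) (skew_sumr B_skew) dotp_sumr.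
by apply: eq_bigr => b _; rewrite mxE !(skewE B_skew) !dotpZr; ring.
Qed.

Lemma dotp_bracket_mxx l x : dotp (x *m bracket_mx l) x = 0.
Proof. by rewrite dotp_bracket_mx (skewxx B_skew) dotpC dotp0l. Qed.

Lemma add1_bracket_unit l : 1%:M + bracket_mx l \in unitmx.
Proof.
rewrite -row_free_unit; apply: inj_row_free => x; rewrite mulmxDr mulmx1.
move=> /eqP; rewrite addr_eq0 => /eqP E; apply: dotp_eq0.
by rewrite {1}E dotpNl dotp_bracket_mxx oppr0.
Qed.

Definition cayley l : 'M[R]_m.+1 :=
  (1%:M - bracket_mx l) *m invmx (1%:M + bracket_mx l).

Lemma cayley_eq l x y :
  y *m (1%:M + bracket_mx l) = x *m (1%:M - bracket_mx l) -> y = x *m cayley l.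
Proof. by move=> E; rewrite /cayley mulmxA -E mulmxK // add1_bracket_unit. Qed.

(** The defining relation reads x - y = (x + y)J with J skew, so x - y is orthogonal to x + y and
    the norms agree. *)
Lemma preserves_enorm_cayley l : preserves_enorm (cayley l).
Proof.
move=> x; set y := x *m cayley l.
have : y *m (1%:M + bracket_mx l) = x *m (1%:M - bracket_mx l).
  by rewrite /y /cayley mulmxA mulmxKV // add1_bracket_unit.
rewrite mulmxDr mulmxBr !mulmx1 => /eqP; rewrite -subr_eq0 => /eqP E.
have := dotp_bracket_mxx l (x + y).
have -> : (x + y) *m bracket_mx l = x - y.
  apply/eqP; rewrite -subr_eq0 -E mulmxDl; apply/eqP.
  by apply/rowP => i; rewrite !mxE; ring.
rewrite dotpDl !dotpDr !dotpNl (dotpC y x) -!enorm2E => H.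
apply/eqP; rewrite -(@eqrXn2 _ 2) ?enorm_ge0 //; apply/eqP; lra.
Qed.

(* Subtracting the Euler-Lagrange equations at consecutive indices eliminates
   the multiplier of the first layer. *)
Lemma energy_min_recurrence K p N w : (0 < N)%N ->
  (forall w', energy K p N w <= energy K p N w') ->
  exists2 A : 'M[R]_m.+1, preserves_enorm A & forall i, (i < N)%N -> w i = w 0%N *m A ^+ i.
Proof.
(* The explicit multiplier of the second layer: penalty strength times endpoint miss, divided by the
   factor N of the energy. *)
move=> N0 wmin; set l := (K / N%:R) *: ((pth w N).2 - p.2).
have NR : (N%:R : R) != 0 by rewrite pnatr_eq0 -lt0n.
exists (cayley l); first exact: preserves_enorm_cayley.
elim=> [|i IH] iN; first by rewrite expr0 mulmx1.
rewrite exprSr mulmxA -IH ?(ltnW iN) //; apply: cayley_eq.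
(* The residual [d] of the Cayley relation is its own test vector: inserted in both Euler-Lagrange
   equations, it gives [dotp d d = 0]. *)
apply/eqP; rewrite -subr_eq0; apply/eqP; set d := (X in X = 0).
have dE : d = (w i.+1 - w i) + (w i + w i.+1) *m bracket_mx l.
  rewrite /d mulmxDr mulmxBr !mulmx1 mulmxDl.
  by apply/rowP => j; rewrite !mxE; ring.
apply: dotp_eq0; rewrite {1}dE; clearbody d.
rewrite dotpDl dotp_bracket_mx /l dotpZl.
have := energy_critical B_skew wmin d iN.
have := energy_critical B_skew wmin d (ltnW iN).
set a := pth w N; rewrite /=; set q := a.2 - p.2; set S := (pth w i).1; clearbody q S a.
rewrite !(skewE B_skew) !(dotpDr, dotpDl, dotpNr, dotpNl, dotpZr, dotpZl) => e1 e2.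
have key : N%:R * (dotp (w i.+1) d - dotp (w i) d) +
    K * (dotp q (B (w i) d) + dotp q (B (w i.+1) d)) = 0 by lra.
by apply: (mulfI NR); rewrite mulr0 -[RHS]key; field.
Qed.

Lemma sqr_sum_le (a : nat -> R) N :
  (\sum_(i < N) a i) ^+ 2 <= N%:R * \sum_(i < N) a i ^+ 2.
Proof.
pose x : 'rV[R]_N := \row_i a i; pose y : 'rV[R]_N := const_mx 1.
have -> : \sum_(i < N) a i = dotp x y by apply: eq_bigr => i _; rewrite !mxE mulr1.
have -> : \sum_(i < N) a i ^+ 2 = enorm x ^+ 2.
  by rewrite enorm2E; apply: eq_bigr => i _; rewrite !mxE expr2.
have -> : N%:R = enorm y ^+ 2.
  rewrite enorm2E /dotp (eq_bigr (fun=> 1)) ?sumr_const ?card_ord //.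
  by move=> i _; rewrite !mxE mulr1.
have [le1 le2] := (dotp_le x y, dotp_le (- x) y).
rewrite dotpNl enormN in le2; rewrite -exprMn mulrC -[leLHS]real_normK ?num_real //.
by rewrite ler_pXn2r ?nnegrE ?mulr_ge0 ?enorm_ge0 // ler_norml; apply/andP; split; lra.
Qed.

Lemma polydist_sqr_le w N :
  D (pth w N) ^+ 2 <= N%:R * \sum_(i < N) dotp (w i) (w i).
Proof.
apply: (@le_trans _ _ (plen w N ^+ 2)).
  by rewrite ler_pXn2r ?nnegrE ?polydist_ge0 ?plen_ge0 ?polydist_le.
apply: le_trans (sqr_sum_le (fun i => enorm (w i)) N) _.
by under eq_bigr do rewrite enorm2E.
Qed.

Definition weight_bound : R := m.+2%:R * annihilator_bound R m.

Lemma weight_bound_ge0 : 0 <= weight_bound.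
Proof. by rewrite mulr_ge0 ?annihilator_bound_ge0. Qed.

(* The weights are chosen so that the perturbed edges see the vertex
   [(pth w T).1] on average; this is the last vertex up to one edge, so that the
   endpoint moves by right multiplication with [h] up to [B (w T) h]. *)
Lemma energy_min_variation K p M w (T := (m.+2 * M)%N) : (0 < M)%N ->
  (forall w', energy K p T.+1 w <= energy K p T.+1 w') ->
  exists2 phi : nat -> R, forall i, `|phi i| <= weight_bound / M%:R &
  forall h, pth (fun i => w i + phi i *: h) T.+1 =
    ((pth w T.+1).1 + h, (pth w T.+1).2 + B ((pth w T.+1).1 - w T) h).
Proof.
move=> M0 wmin; have [A AI wA] := energy_min_recurrence (ltn0Sn T) wmin.
pose u i := w 0%N *m A ^+ i.
(* Midpoint of edge [j]. Consecutive midpoints differ by half the sum of two edges, which is a fixed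
   vector times [A ^+ j]. *)
pose Z j := (pth u j).1 + 2^-1 *: u j.
have ZS j : Z j.+1 = Z j + (2^-1 *: (w 0%N + w 0%N *m A)) *m A ^+ j.
  rewrite /Z /= /u -scalemxAl mulmxDl -mulmxA -[A *m _]/(A * A ^+ j) -exprS.
  by apply/rowP => i; rewrite !mxE; field.
have [phi [phi1 phiZ phi_le]] := averaged_weights ZS AI M0.
(* The last edge [T] gets weight 0: its midpoint [Z T] is the target, and [2 *: Z T] minus the
   endpoint is the vertex before that edge. *)
pose psi i := if (i < T)%N then phi i else 0.
have psi_sum (V : lmodType R) (f : nat -> V) :
    \sum_(i < T.+1) psi i *: f i = \sum_(i < T) phi i *: f i.
  rewrite big_ord_recr /= {2}/psi ltnn scale0r addr0.
  by apply: eq_bigr => i _; rewrite /psi ltn_ord.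
have psi1 : \sum_(i < T.+1) psi i = 1.
  have := psi_sum R^o (fun=> 1); rewrite /GRing.scale /=.
  by under eq_bigr do rewrite mulr1; under [in RHS]eq_bigr do rewrite mulr1; rewrite phi1.
exists psi.
  move=> i; rewrite /psi; case: ifP => [_|_]; first exact: phi_le.
  by rewrite normr0 divr_ge0 ?weight_bound_ge0.
move=> h; rewrite (pth_perturb B_skew) psi1 scale1r; congr (_, _ + B _ h).
have uw j : (j <= T.+1)%N -> pth w j = pth u j.
  by move=> jT; apply: eq_pth => i ij; apply: wA; apply: leq_trans jT.
have uT : u T = w T by rewrite (wA T (ltnSn T)).
have PS : (pth w T.+1).1 = (pth w T).1 + w T by [].
rewrite (psi_sum _ (fun j => 2 *: (pth w j).1 + w j - (pth w T.+1).1)).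
transitivity (2 *: Z T - (pth w T.+1).1).
  have cE : (pth w T.+1).1 = \sum_(i < T) phi i *: (pth w T.+1).1.
    by rewrite -scaler_suml phi1 scale1r.
  rewrite [X in _ = _ - X]cE -phiZ scaler_sumr -sumrB.
  apply: eq_bigr => i _; rewrite /Z -(uw i (ltnW (leqW (ltn_ord i)))).
  rewrite (_ : u i = w i); last by rewrite (wA i (leqW (ltn_ord i))).
  move: (pth w i).1 (w i) (pth w T.+1).1 => a b c.
  by apply/rowP => j; rewrite !mxE; field.
rewrite /Z -(uw T (leqnSn T)) uT PS; move: (pth w T).1 (w T) => a b.
by apply/rowP => i; rewrite !mxE; field.
Qed.

End SquaredDistance.

(** * Horizontal semiconcavity of the squared distance *)

Section HorizontalSemiconcavity.
Context (R : realType) (m n2 : nat).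
Context (B : 'rV[R]_m.+1 -> 'rV[R]_m.+1 -> 'rV[R]_n2).
Context (B_skew : skew_bilinear B) (B_span : B_spanning B).
Local Notation G := (carnot_pt R m.+1 n2).
Implicit Types (p : G) (w : nat -> 'rV[R]_m.+1) (h : 'rV[R]_m.+1).
Local Notation pth := (pth B).
Local Notation energy := (energy B).
Local Notation D := (polydist B).
Local Notation "p ** q" := (gmul B p q) (at level 40, left associativity).

(** Value of [2 (N c)^2] for weights of size [c = weight_bound / M] on [N = m.+2 * M + 1] edges,
    using [N <= 2 * m.+2 * M]. *)
Definition semiconcavity_bound : R := 2 * (2 * m.+2%:R * weight_bound R m) ^+ 2.

Lemma semiconcavity_bound_ge0 : 0 <= semiconcavity_bound.
Proof. by rewrite mulr_ge0 ?sqr_ge0. Qed.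

Lemma energy_almost_reached p L C K N w : (0 < N)%N -> 0 <= L -> 0 <= C -> 0 <= K ->
  (forall i, (i < N)%N -> enorm (w i) <= L / N%:R) ->
  (pth w N).1 = p.1 -> enorm ((pth w N).2 - p.2) <= C / N%:R ->
  energy K p N w <= L ^+ 2 + K * C ^+ 2 / N%:R.
Proof.
move=> N0 L0 C0 K0 wL w1 w2; rewrite /energy w1 subrr dotp0l add0r.
have NR : 0 < N%:R :> R by rewrite ltr0n.
rewrite lerD //.
  rewrite (_ : L ^+ 2 = N%:R * \sum_(i < N) (L / N%:R) ^+ 2); last first.
    by rewrite sumr_const card_ord -mulr_natr; field; rewrite gt_eqF.
  rewrite ler_wpM2l ?ler0n //; apply: ler_sum => i _; rewrite -enorm2E.
  by rewrite ler_pXn2r ?nnegrE ?enorm_ge0 ?divr_ge0 ?wL ?ler0n.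
rewrite -mulrA ler_wpM2l // -enorm2E.
apply: (@le_trans _ _ ((C / N%:R) ^+ 2)).
  by rewrite ler_pXn2r ?nnegrE ?enorm_ge0 ?divr_ge0 ?ler0n.
rewrite exprMn ler_wpM2l ?sqr_ge0 // expr2 ler_piMl ?invr_ge0 ?ler0n //.
by rewrite invf_le1 // ler1n.
Qed.

(** Parallelogram identity on each edge: the terms linear in [h] cancel, and the quadratic ones add
    up to at most [N c^2 |h|^2] before the factor N. *)
Lemma energy_variation_le K p N w (phi : nat -> R) c h : (0 <= K) ->
  (forall i, `|phi i| <= c) ->
  N%:R * (\sum_(i < N) dotp (w i + phi i *: h) (w i + phi i *: h)) +
  N%:R * (\sum_(i < N) dotp (w i + phi i *: - h) (w i + phi i *: - h)) <=
  2 * energy K p N w + 2 * (N%:R * c) ^+ 2 * enorm h ^+ 2.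
Proof.
move=> K0 phic; rewrite -mulrDr -big_split /=.
rewrite (eq_bigr (fun i : 'I_N =>
  2 * dotp (w i) (w i) + 2 * (phi i ^+ 2 * enorm h ^+ 2))); last first.
  move=> i _; rewrite enorm2E !(dotpDl, dotpDr, dotpZl, dotpZr, dotpNl, dotpNr).
  by rewrite (dotpC h); ring.
rewrite big_split /= mulrDr -!mulr_sumr; apply: lerD.
  rewrite /energy mulrCA ler_wpM2l // lerDl mulr_ge0 // addr_ge0 ?dotp_ge0 //.
rewrite -mulr_suml.
have le1 : \sum_(i < N) phi i ^+ 2 <= N%:R * c ^+ 2.
  rewrite -[N in N%:R]card_ord mulr_natl -sumr_const; apply: ler_sum => i _.
  rewrite -(@real_normK _ (phi i)) ?num_real // ler_pXn2r ?nnegrE //.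
  by rewrite (le_trans _ (phic i)).
rewrite exprMn expr2.
have h0 : 0 <= enorm h ^+ 2 by exact: sqr_ge0.
have := ler_wpM2r h0 le1; have N0 : 0 <= N%:R :> R by rewrite ler0n.
move/(ler_wpM2l N0); lra.
Qed.

(** [E] is the endpoint of the unperturbed polygon and [s] the defect [B (w T) h] left by the last
    edge. Replacing [p] by [E] also costs the cross term [B (p.1 - E.1) h]. *)
Lemma polydist_variation_le p h (s : 'rV[R]_n2) (E : G) d theta :
  (forall q, enorm ((p ** hor n2 h).1 - q.1) <= d ->
     enorm ((p ** hor n2 h).2 - q.2) <= d ->
     D (ginv q ** (p ** hor n2 h)) <= theta) ->
  enorm (E.1 - p.1) <= d ->
  enorm (E.2 - p.2) + enorm s + skew_bound B * (enorm (E.1 - p.1) * enorm h) <= d ->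
  D (p ** hor n2 h) <= D (E.1 + h, E.2 + (B E.1 h - s)) + theta.
Proof.
move=> H le1 le2; set q := (_, _).
have -> : p ** hor n2 h = q ** (ginv q ** (p ** hor n2 h)).
  by rewrite (gmulA B_skew) (gmulVr B_skew) (gmul0l B_skew).
apply: le_trans (polydistM B_skew B_span _ _) _; rewrite lerD2l; apply: H => /=.
  by rewrite opprD addrACA subrr addr0 enormB.
rewrite addr0; have -> : p.2 + B p.1 h - (E.2 + (B E.1 h - s)) =
    (p.2 - E.2) + s + B (p.1 - E.1) h.
  by rewrite !(skewE B_skew); apply/rowP => i; rewrite !mxE; ring.
apply: le_trans (enormD _ _) _; apply: le_trans le2; apply: lerD.
  by apply: le_trans (enormD _ _) _; rewrite enormB.
by rewrite (enormB E.1); exact: enorm_skew_le.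
Qed.

(** The parameters are fixed in the order [theta], [d], [eta], [K], [mu], and last the number of
    edges. The penalty [K] may thus be huge, as the almost reaching polygons pay only [K C^2 / N]
    for it. *)
Lemma polydist_semiconcave_of_almost_reached p L h : 0 <= L -> almost_reached B p L ->
  D (p ** hor n2 h) ^+ 2 + D (p ** hor n2 (- h)) ^+ 2 <=
    2 * L ^+ 2 + semiconcavity_bound * enorm h ^+ 2.
Proof.
move=> L0 [C C0 pL]; apply/ler_addgt0Pr => eps e0.
set r0 := L ^+ 2 + 1; set nh := enorm h.
have nh0 : 0 <= nh by exact: enorm_ge0.
have r00 : 0 < r0 by have := sqr_ge0 L; rewrite /r0; lra.
set r1 := 2 * r0 + semiconcavity_bound * nh ^+ 2 + 1.
have r11 : 1 <= r1.
  by rewrite lerDr addr_ge0 ?mulr_ge0 ?semiconcavity_bound_ge0 ?sqr_ge0 // ltW.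
set theta := Num.min 1 (eps / (4 * (2 * r1 + 1))).
have t0 : 0 < theta.
  by rewrite lt_min ltr01 divr_gt0 // mulr_gt0 // addr_gt0 // mulr_gt0 //; lra.
have theta1 : theta <= 1 by rewrite ge_min lexx.
have theta2 : 4 * (theta * (2 * r1 + 1)) <= eps.
  have : theta <= eps / (4 * (2 * r1 + 1)) by rewrite ge_min lexx orbT.
  by rewrite ler_pdivlMr; lra.
have [d1 d10 H1] := polydist_continuous B_skew B_span (p ** hor n2 h) t0.
have [d2 d20 H2] := polydist_continuous B_skew B_span (p ** hor n2 (- h)) t0.
set d := Num.min d1 d2.
have d0 : 0 < d by rewrite lt_min d10.
have dd1 : d <= d1 by rewrite ge_min lexx.
have dd2 : d <= d2 by rewrite ge_min lexx orbT.
(* One unit for the endpoint miss, and one [skew_bound B * nh] each for the last-edge defect and the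
   cross term. *)
set c := 1 + 2 * (skew_bound B * nh).
have sb0 := skew_bound_ge0 B.
have sbh : 0 <= skew_bound B * nh by rewrite mulr_ge0.
have c1 : 1 <= c by rewrite /c; lra.
have c0 : 0 < c by lra.
set eta := d / c.
have eta0 : 0 < eta by rewrite divr_gt0.
have etad : eta * c = d by rewrite /eta divfK // gt_eqF.
(* With energy at most [r0], this strength forces the endpoint miss below [eta]. *)
set K := r0 / eta ^+ 2.
have K0 : 0 < K by rewrite divr_gt0 // exprn_gt0.
set mu := Num.min 1 (eps / 4).
have mu0 : 0 < mu by rewrite lt_min ltr01 divr_gt0.
have mu1 : mu <= 1 by rewrite ge_min lexx.
have mu2 : mu <= eps / 4 by rewrite ge_min lexx orbT.
(* The first summand makes the penalty of the competitor at most [mu]; the second makes the last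
   edge at most [eta], from [N |w T|^2 <= r0]. *)
set X := K * C ^+ 2 / mu + r0 / eta ^+ 2.
have X0 : 0 < X.
  apply: ltr_wpDl; last by rewrite divr_gt0 // exprn_gt0.
  exact: divr_ge0 (mulr_ge0 (ltW K0) (sqr_ge0 C)) (ltW mu0).
set M := (Num.bound X); have MX : X < M%:R by rewrite archi_boundP // ltW.
have M0 : (0 < M)%N by rewrite -(ltr0n R) (lt_trans X0).
set T := (m.+2 * M)%N; set N := T.+1.
have MN : M%:R <= N%:R :> R by rewrite ler_nat ltnW // ltnS leq_pmull.
have NR : 0 < N%:R :> R by rewrite ltr0n.
have XN : X <= N%:R by apply: ltW; apply: lt_le_trans MX MN.
have [w wmin] := energy_min B_skew p (ltW K0) (ltn0Sn T).
have wE : energy K p N w <= L ^+ 2 + mu.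
  have [w0 [w01 w02 w03]] := pL N (ltn0Sn T).
  apply: le_trans (wmin w0) _.
  apply: le_trans (energy_almost_reached (ltn0Sn T) L0 C0 (ltW K0) w01 w02 w03) _.
  rewrite lerD2l ler_pdivrMr // -ler_pdivrMl // mulrC; apply: le_trans XN.
  by rewrite lerDl divr_ge0 // ltW // exprn_gt0.
have wr0 : energy K p N w <= r0 by apply: le_trans wE _; rewrite lerD2l.
have [phi phi_le phiE] := energy_min_variation B_skew M0 wmin.
set E := pth w N in phiE *.
have Eeta : dotp (E.1 - p.1) (E.1 - p.1) + dotp (E.2 - p.2) (E.2 - p.2) <= eta ^+ 2.
  rewrite -(ler_pM2l K0) {2}/K divfK ?gt_eqF ?exprn_gt0 //; apply: le_trans wr0.
  by rewrite /energy -/E lerDr mulr_ge0 ?ler0n // sumr_ge0 // => i _; exact: dotp_ge0.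
have sq_le (k : nat) (x : 'rV[R]_k) : dotp x x <= eta ^+ 2 -> enorm x <= eta.
  by rewrite -enorm2E ler_pXn2r ?nnegrE ?enorm_ge0 // ltW.
have E1 : enorm (E.1 - p.1) <= eta.
  apply: sq_le; have := dotp_ge0 (E.2 - p.2); lra.
have E2 : enorm (E.2 - p.2) <= eta.
  apply: sq_le; have := dotp_ge0 (E.1 - p.1); lra.
have wT : enorm (w T) <= eta.
  apply: sq_le; rewrite -(ler_pM2l NR).
  apply: (@le_trans _ _ r0).
    apply: le_trans wr0; rewrite /energy.
    apply: (@le_trans _ _ (N%:R * \sum_(i < N) dotp (w i) (w i))).
      rewrite ler_wpM2l ?ler0n // big_ord_recr /= lerDr sumr_ge0 // => i _; exact: dotp_ge0.
    by rewrite lerDl mulr_ge0 ?addr_ge0 ?dotp_ge0 // ltW.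
  rewrite -ler_pdivrMr ?exprn_gt0 //; apply: le_trans XN.
  by rewrite lerDr (divr_ge0 (mulr_ge0 (ltW K0) (sqr_ge0 C)) (ltW mu0)).
have etad' : eta <= d by rewrite -etad ler_peMr // ltW.
have step (k : 'rV[R]_m.+1) d' : enorm k = nh -> d <= d' ->
    (forall q, enorm ((p ** hor n2 k).1 - q.1) <= d' ->
     enorm ((p ** hor n2 k).2 - q.2) <= d' ->
     D (ginv q ** (p ** hor n2 k)) <= theta) ->
    D (p ** hor n2 k) <= D (pth (fun i => w i + phi i *: k) N) + theta.
  move=> knh dd' H; rewrite phiE (skewDl B_skew) (skewNl B_skew).
  apply: (polydist_variation_le (E := E) H); first by rewrite (le_trans E1) ?(le_trans etad').
  apply: le_trans dd'; rewrite -etad knh.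
  have le1 : enorm (B (w T) k) <= skew_bound B * (eta * nh).
    apply: le_trans (enorm_skew_le B_skew _ _) _.
    by rewrite knh ler_wpM2l // ler_wpM2r.
  have le2 : skew_bound B * (enorm (E.1 - p.1) * nh) <= skew_bound B * (eta * nh).
    by rewrite ler_wpM2l // ler_wpM2r.
  rewrite /c; lra.
have := step h d1 erefl dd1 H1; have := step (- h) d2 (enormN h) dd2 H2.
have := polydist_sqr_le B (fun i => w i + phi i *: h) N.
have := polydist_sqr_le B (fun i => w i + phi i *: - h) N.
have := energy_variation_le p N w h (ltW K0) phi_le.
have Cle : 2 * (N%:R * (weight_bound R m / M%:R)) ^+ 2 * nh ^+ 2 <=
    semiconcavity_bound * nh ^+ 2.
  rewrite ler_wpM2r ?sqr_ge0 // /semiconcavity_bound ler_wpM2l //.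
  rewrite ler_pXn2r ?nnegrE ?mulr_ge0 ?divr_ge0 ?weight_bound_ge0 ?ler0n //.
  rewrite mulrA ler_pdivrMr ?ltr0n // mulrAC ler_wpM2r ?weight_bound_ge0 //.
  by rewrite -mulrA -!natrM -/T ler_nat mul2n -addnn -[N]addn1 leq_add2l muln_gt0.
(* Squaring [x <= y + theta] costs [2 theta y + theta^2]; here [y <= r1] follows from [y^2 <= r1]
   and [r1 >= 1]. *)
have D_sqr (x y a : R) : 0 <= x -> 0 <= y -> x <= y + theta -> y ^+ 2 <= a -> a <= r1 ->
    x ^+ 2 <= a + theta * (2 * r1 + 1).
  move=> x0 y0 xy ya ar.
  have yr : y <= r1 by have := sqr_ge0 (y - 1); rewrite sqrrB; lra.
  apply: (@le_trans _ _ ((y + theta) ^+ 2)).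
    by rewrite ler_pXn2r ?nnegrE ?addr_ge0 // ltW.
  have ty : theta * y <= theta * r1 by rewrite ler_wpM2l // ltW.
  have tt : theta * theta <= theta * 1 by rewrite ler_wpM2l // ltW.
  rewrite sqrrD [theta ^+ 2]expr2; lra.
rewrite -/nh; set A1 := N%:R * _; set A2 := N%:R * _ => var D2A D1A D2 D1.
have A10 : 0 <= A1 by apply: le_trans D1A; exact: sqr_ge0.
have A20 : 0 <= A2 by apply: le_trans D2A; exact: sqr_ge0.
have A12 : A1 + A2 <= 2 * (L ^+ 2 + mu) + semiconcavity_bound * nh ^+ 2.
  by apply: le_trans var _; apply: lerD Cle; rewrite ler_wpM2l.
have [A1r A2r] : A1 <= r1 /\ A2 <= r1.
  by rewrite /r1 /r0; clear -A10 A20 A12 mu1; split; lra.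
have P0 := polydist_ge0 B.
have := D_sqr _ _ _ (P0 _) (P0 _) D1 D1A A1r.
have := D_sqr _ _ _ (P0 _) (P0 _) D2 D2A A2r.
clear -A12 mu2 theta2; clearbody mu theta r1 A1 A2.
set X1 := D _ ^+ 2; set X2 := D _ ^+ 2; lra.
Qed.

End HorizontalSemiconcavity.

(** * From admissible curves to polygons and back *)

Section AbsolutelyContinuousIncrement.
Context (R : realType).
Notation mu := (@lebesgue_measure R).
Implicit Types (f F G : R -> R) (a b u v x : R).

(** Let [c] be the supremum of the points [x] with [P a x]. The local property at [c] joins a point
    just below to one just above, so [c] cannot stop short of [b]. *)
Lemma cousin (P : R -> R -> Prop) a b : a <= b ->
  (forall u v w, a <= u -> u <= v -> v <= w -> w <= b -> P u v -> P v w -> P u w) ->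
  (forall x, a <= x <= b -> exists2 d, 0 < d & forall u v,
     a <= u -> u <= x -> x <= v -> v <= b -> x - d < u -> v < x + d -> P u v) ->
  P a b.
Proof.
move=> ab Ptrans Ploc; pose S := [set x | a <= x <= b /\ P a x].
have Sa : S a.
  split; first by rewrite lexx ab.
  have [|d d0 H] := Ploc a; first by rewrite lexx ab.
  by apply: H => //; lra.
have Sb : ubound S b by move=> x [/andP[]].
have hS : has_sup S by split; [exists a | exists b].
set c := sup S; have ac : a <= c by exact: (ub_le_sup hS.2).
have cb : c <= b by apply: ge_sup => //; exists a.
have [d d0 H] := Ploc c (introT andP (conj ac cb)).
have [x [/andP[ax xb] Pax] xc] := sup_adherent d0 hS; rewrite -/c in xc.
have xlec : x <= c by apply: (ub_le_sup hS.2); split => //; rewrite ax xb.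
pose v := Num.min b (c + d / 2).
have cv : c <= v by rewrite le_min cb lerDl divr_ge0 // ltW.
have vd : v < c + d.
  by rewrite gt_min; apply/orP; right; rewrite ltrD2l ltr_pdivrMr //; lra.
have vb : v <= b by rewrite ge_min lexx.
have Pav : P a v.
  have xv : x <= v by exact: le_trans cv.
  by apply: (Ptrans a x v) => //; apply: H => //; lra.
have : v <= c.
  by apply: (ub_le_sup hS.2); split => //; rewrite vb (le_trans ac).
rewrite ge_min => /orP[bc|]; last by lra.
by rewrite (_ : b = v) //; apply/eqP; rewrite eq_le vb (le_trans bc cv).
Qed.

(** Straddle lemma: the interval must contain [x], since the derivative compares values only with
    that at [x]; the errors of the two sides then add up to [e * (v - u)]. *)
Lemma derivable_increment_le G x e : 0 < e -> derivable G x 1 -> derive1 G x <= 0 ->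
  exists2 d, 0 < d & forall u v, u <= x -> x <= v -> x - d < u -> v < x + d ->
    G v - G u <= e * (v - u).
Proof.
move=> e0 dG G'; rewrite derive1E in G'.
have : h^-1 *: (G (h *: 1 + x) - G x) @[h --> 0^'] --> 'D_1 G x by exact: dG.
move=> /cvgrPdist_le /(_ _ e0); rewrite near_withinE => /nbhs_ballP[d /= d0 H].
have bound h : `|h| < d -> G (x + h) - G x <= 'D_1 G x * h + e * `|h|
    /\ 'D_1 G x * h - e * `|h| <= G (x + h) - G x.
  move=> hd; have [->|h0] := eqVneq h 0.
    by rewrite addr0 subrr normr0 !mulr0 addr0 subr0.
  have := H h; rewrite -ball_normE /= sub0r normrN => /(_ hd h0).
  rewrite /GRing.scale /= mulr1 (addrC h).
  set q := _ - G x; set D := 'D_1 G x => le1.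
  have : `|D * h - q| <= e * `|h|.
    rewrite (_ : _ - q = (D - h^-1 * q) * h); last by field.
    by rewrite normrM ler_wpM2r.
  by rewrite ler_norml => /andP[]; split; lra.
exists d => // u v ux xv ud vd.
have h1 : `|v - x| < d by rewrite ger0_norm; lra.
have h2 : `|u - x| < d by rewrite ler0_norm; lra.
have [+ _] := bound _ h1; have [_] := bound _ h2.
rewrite !(addrC x) !subrK (ger0_norm (x := v - x)); last by lra.
rewrite (ler0_norm (x := u - x)); last by lra.
have : 'D_1 G x * (v - u) <= 0 by rewrite mulr_le0_ge0 //; lra.
lra.
Qed.

(* Cousin's lemma replaces a Vitali covering: intervals tagged at exceptional
   points lie in a small open set, where absolute continuity applies; on the
   others the derivative controls the increment. *)
Lemma abs_cont01_increment_le f F a b : abs_cont01 f ->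
  0 <= a -> a <= b -> b <= 1 ->
  (forall u v, a <= u -> u <= v -> v <= b -> F u <= F v) ->
  {ae mu, forall t, t \in `]a, b[%R ->
     [/\ derivable f t 1, derivable F t 1 & derive1 f t <= derive1 F t]} ->
  f b - f a <= F b - F a.
Proof.
move=> fac a0 ab b1 Fmono ae_le.
suff : f b - F b - (f a - F a) <= 0 by lra.
apply/ler_addgt0Pr => eps eps0; rewrite add0r.
set e := eps / (b - a + 1).
have ba : 0 < b - a + 1 by lra.
have e0 : 0 < e by rewrite divr_gt0.
have half0 : 0 < eps / 2 by rewrite divr_gt0.
have e0' : 0 < e / 2 by rewrite divr_gt0.
have [d d0 facd] := fac _ half0.
have [A [mA A0 sub]] := ae_le.
(* The endpoints join the exceptional set because the almost everywhere hypothesis concerns the open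
   interval only. *)
have [U [opU AU muU]] : exists U : set R, [/\ open U, A `|` [set a; b] `<=` U & (mu U < d%:E)%E].
  have mD : measurable (A `|` [set a; b]).
    by apply: measurableU => //; apply: measurableU; exact: measurable_set1.
  have D0 : mu (A `|` [set a; b]) = 0%E.
    apply: null_set_setU => //; first by apply: measurableU; exact: measurable_set1.
    by apply: countable_lebesgue_measure0; apply: finite_set_countable; exact: finite_set2.
  have Dy : (mu (A `|` [set a; b]) < +oo)%E by rewrite D0 ltry.
  have [U [opU AU muU]] := lebesgue_regularity_outer mD Dy d0.
  exists U; split => //; suff -> : mu U = mu (U `\` (A `|` [set a; b])) by exact: muU.
  rewrite -[in LHS](setDUK AU) setUC measureU0 //.
  by apply: measurableD => //; exact: open_measurable.
have mU : measurable U by exact: open_measurable.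
pose G t := f t - F t.
(* The intervals [[p i, q i]] are those tagged at exceptional points. Half-open [[u, v[] makes the
   measure bound additive under concatenation. *)
pose P u v := exists (k : nat) (p q : nat -> R),
  [/\ forall i, (i < k)%N -> u <= p i /\ p i <= q i /\ q i <= v,
     forall i, (i.+1 < k)%N -> q i <= p i.+1,
     ((\sum_(i < k) (q i - p i))%:E <= mu (U `&` `[u, v[))%E &
     G v - G u <= e / 2 * (v - u) + \sum_(i < k) `|f (q i) - f (p i)|].
have Pab : P a b.
  apply: cousin => // [u v w au uv vw wb|x /andP[ax xb]].
    move=> [k [p [q [pq1 pq2 pq3 pq4]]]] [k' [p' [q' [pq1' pq2' pq3' pq4']]]].
    pose cat (r r' : nat -> R) i := if (i < k)%N then r i else r' (i - k)%N.
    have cat_sum (g : R -> R -> R) : \sum_(i < k + k') g (cat p p' i) (cat q q' i) =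
        \sum_(i < k) g (p i) (q i) + \sum_(i < k') g (p' i) (q' i).
      rewrite big_split_ord /=; congr (_ + _); apply: eq_bigr => i _; rewrite /cat.
        by rewrite ltn_ord.
      by rewrite ltnNge leq_addr /= addKn.
    exists (k + k')%N, (cat p p'), (cat q q'); split.
    - move=> i ik; rewrite /cat; case: ltnP => ki.
        by have [? [? ?]] := pq1 i ki; split => //; split => //; lra.
      have [] := pq1' (i - k)%N; first by rewrite ltn_subLR.
      by move=> ? [? ?]; split; [lra | split].
    - move=> i ik; rewrite /cat; case: ltnP => ki; case: ltnP => ki'.
      + exact: pq2.
      + have [_ [_ qv]] := pq1 i ki.
        have [|vp _] := pq1' (i.+1 - k)%N; first by rewrite ltn_subLR.
        exact: le_trans qv vp.
      + by rewrite ltnNge (leq_trans ki) in ki'.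
      + by rewrite subSn //; apply: pq2'; rewrite -subSn // ltn_subLR // leqW.
    - rewrite (cat_sum (fun s t => t - s)) EFinD.
      have -> : U `&` `[u, w[ = (U `&` `[u, v[) `|` (U `&` `[v, w[).
        rewrite -setIUr; congr (_ `&` _); apply/seteqP; split => t /=; rewrite !in_itv /=.
          by case/andP => ut tw; case: (ltP t v) => tv; [left; rewrite ut | right].
        by case=> /andP[ut tv]; apply/andP; split => //; lra.
      rewrite measureU ?leeD //; try by apply: measurableI.
      apply/seteqP; split => t //= [[_ +] [_]]; rewrite !in_itv /=.
      by move=> /andP[_ tv] /andP[vt _]; rewrite ltNge vt in tv.
    - rewrite (cat_sum (fun s t => `|f t - f s|)); lra.
  have [xA|xA] := pselect ((A `|` [set a; b]) x).
    have [d' /= d'0 Hd'] : exists2 d', 0 < d' & ball x d' `<=` U.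
      by apply/nbhs_ballP; apply: open_nbhs_nbhs; split => //; exact: AU.
    exists d' => // u v au ux xv vb xu vx.
    exists 1%N, (fun=> u), (fun=> v); split => //.
    - by move=> i _; split => //; split => //; lra.
    - rewrite big_ord1 (_ : U `&` `[u, v[ = `[u, v[%classic).
        have [uv|uv] := ltP u v; first by rewrite lebesgue_measure_itv /= lte_fin uv.
        by rewrite (_ : v - u = 0) //; lra.
      apply/setIidPr => t; rewrite /= in_itv /= => /andP[ut tv]; apply: Hd'.
      by rewrite -ball_normE /= ltr_norml; lra.
    - have Fuv : F u <= F v by apply: Fmono => //; lra.
      rewrite big_ord1 /G; have := ler_norm (f v - f u).
      have : 0 <= e / 2 * (v - u) by rewrite mulr_ge0 //; lra.
      lra.
  have [df dF fF] : [/\ derivable f x 1, derivable F x 1 & derive1 f x <= derive1 F x].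
    apply: contrapT => H; apply: (xA); left; apply: sub => /= H'; apply: H; apply: H'.
    rewrite in_itv /=; apply/andP; split; rewrite lt_neqAle ?ax ?xb andbT.
      by apply/eqP => E; apply: (xA); right; left.
    by apply/eqP => E; apply: (xA); right; right.
  have dG : derivable G x 1 by exact: derivableB.
  have G'0 : derive1 G x <= 0.
    by rewrite derive1E deriveB // -!derive1E subr_le0.
  have [d' d'0 Hd'] := derivable_increment_le e0' dG G'0.
  exists d' => // u v au ux xv vb xu vx.
  exists 0%N, (fun=> 0), (fun=> 0); split => //.
  - by rewrite big_ord0 measure_ge0.
  - by rewrite big_ord0 addr0; apply: Hd'.
have [k [p [q [pq1 pq2 pq3 pq4]]]] := Pab.
have small : \sum_(i < k) `|f (q i) - f (p i)| < eps / 2.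
  apply: facd.
  - by move=> i ik; have [? [? ?]] := pq1 i ik; split; [lra | split => //; lra].
  - exact: pq2.
  - rewrite -lte_fin; apply: le_lt_trans pq3 _; apply: le_lt_trans muU.
    by apply: le_measure; rewrite ?inE //; apply: measurableI.
have : e / 2 * (b - a) <= eps / 2.
  have : e * (b - a + 1) = eps by rewrite /e divfK // gt_eqF.
  lra.
rewrite /G in pq4; lra.
Qed.

End AbsolutelyContinuousIncrement.

(** * Absolute continuity and primitives of nonnegative integrable functions *)

Section Primitive.
Context (R : realType).
Notation mu := (@lebesgue_measure R).

Lemma abs_cont01_const (c : R) : abs_cont01 (fun=> c).
Proof.
move=> e e0; exists 1 => // k a b _ _ _.
by rewrite big1 // => i _; rewrite subrr normr0.
Qed.

Lemma abs_cont01D (f g : R -> R) :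
  abs_cont01 f -> abs_cont01 g -> abs_cont01 (fun t => f t + g t).
Proof.
move=> fc gc e e0; have h0 : 0 < e / 2 by rewrite divr_gt0.
have [d d0 fd] := fc _ h0; have [d' d'0 gd] := gc _ h0.
exists (Num.min d d'); first by rewrite lt_min d0.
move=> k a b ab1 ab2; rewrite lt_min => /andP[sd sd'].
have := fd k a b ab1 ab2 sd; have := gd k a b ab1 ab2 sd'.
move=> lt1 lt2; apply: (@le_lt_trans _ _
  (\sum_(i < k) (`|f (b i) - f (a i)| + `|g (b i) - g (a i)|))); last first.
  rewrite big_split /=; lra.
by apply: ler_sum => i _; rewrite opprD addrACA ler_normD.
Qed.

Lemma abs_cont01Z (c : R) (f : R -> R) : abs_cont01 f -> abs_cont01 (fun t => c * f t).
Proof.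
move=> fc e e0; have c0 : 0 < `|c| + 1 by rewrite ltr_wpDl.
have [d d0 fd] := fc _ (divr_gt0 e0 c0).
exists d => // k a b ab1 ab2 sd; have := fd k a b ab1 ab2 sd.
rewrite ltr_pdivlMr //; apply: le_lt_trans; rewrite mulr_suml.
apply: ler_sum => i _; rewrite -mulrBr normrM mulrC ler_wpM2l // lerDl.
exact: ler01.
Qed.

Lemma abs_cont01_sum (I : Type) (s : seq I) (f : I -> R -> R) :
  (forall i, abs_cont01 (f i)) -> abs_cont01 (fun t => \sum_(i <- s) f i t).
Proof.
move=> fc; elim: s => [|i s IH].
  by under eq_fun do rewrite big_nil; exact: (@abs_cont01_const 0).
by under eq_fun do rewrite big_cons; exact: (abs_cont01D (fc i) IH).
Qed.

Lemma primitive (k : R -> R) (L : R) :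
  measurable_fun (`[0, 1]%classic : set R) k -> (forall t, 0 <= k t) ->
  (\int[mu]_(t in (`[0%R, 1%R]%classic : set R)) (k t)%:E = L%:E)%E ->
  exists F : R -> R, [/\ F 0 = 0, F 1 = L,
    forall a b, 0 <= a -> a <= b -> b <= 1 -> F a <= F b,
    {within `[0, 1]%classic, continuous F} &
    {ae mu, forall t, t \in `]0, 1[%R -> derivable F t 1 /\ derive1 F t = k t}].
Proof.
move=> mk k0 kL; set I := (`[0, 1]%classic : set R).
have mI : measurable I by exact: measurable_itv.
have intI : mu.-integrable I (EFin \o k).
  apply/integrableP; split; first exact/measurable_EFinP.
  under eq_integral do rewrite /= ger0_norm //.
  by rewrite kL ltry.
(* Extension by zero gives a function integrable on the whole line, as the differentiation theorem
   [FTC1] is applied there. *)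
pose f := k \_ I.
have f0 t : 0 <= f t by rewrite /f patchE; case: ifP.
have intf : mu.-integrable setT (EFin \o f).
  by rewrite -restrict_EFin; apply/integrable_restrict => //=; rewrite setTI.
have intfS (A : set R) : measurable A -> mu.-integrable A (EFin \o f).
  by move=> mA; apply: integrableS intf.
have locf : locally_integrable [set: R] f by exact: integrable_locally.
pose F x := (\int[mu]_(t in `[0, x]) f t)%R.
exists F; split.
- by rewrite /F set_itv1 Rintegral_set1.
- rewrite /F /Rintegral -[RHS]/(fine L%:E) -kL; congr fine.
  by apply: eq_integral => t tI; rewrite /f patchE tI.
- move=> a b a0 ab b1; rewrite /F /Rintegral; apply: fine_le.
  + by apply: integrable_fin_num => //; apply: intfS; exact: measurable_itv.
  + by apply: integrable_fin_num => //; apply: intfS; exact: measurable_itv.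
  + apply: ge0_subset_integral => //.
    * by have /integrableP[] := intfS `[0, b]%classic (measurable_itv _).
    * by move=> t _; rewrite lee_fin.
    * by apply: subset_itvl; rewrite bnd_simp.
- by apply: (@parameterized_integral_continuous R 0 1 f) => //; exact: intfS.
- have := @FTC1 R f (BLeft 0) (fun y => intfS _ (measurable_itv _)) locf.
  apply: filterS; first exact: (ae_filter_ringOfSetsType mu).
  move=> t Ht; rewrite in_itv /= => /andP[t0 t1].
  have [|dF F'] := Ht; first by rewrite lte_fin.
  split => //; rewrite F' /f patchE mem_set //.
  by rewrite /I /= in_itv /= !ltW.
Qed.

End Primitive.

(** * Discretisation of admissible curves *)

Section AdmissibleToPolygon.
Context (R : realType) (m n2 : nat).
Context (B : 'rV[R]_m -> 'rV[R]_m -> 'rV[R]_n2) (B_skew : skew_bilinear B).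
Local Notation G := (carnot_pt R m n2).
Notation mu := (@lebesgue_measure R).
Local Notation "p ** q" := (gmul B p q) (at level 40, left associativity).
Implicit Types (p q : G) (gamma : R -> G) (u : R -> 'rV[R]_m).

Lemma is_derive_dotp k (f : R -> 'rV[R]_k) (df c : 'rV[R]_k) t :
  (forall j, derivable (fun s => f s 0 j) t 1 /\ derive1 (fun s => f s 0 j) t = df 0 j) ->
  is_derive t 1 (fun s => dotp (f s) c) (dotp df c).
Proof.
move=> fd; rewrite /dotp.
have H (j : 'I_k) : is_derive t 1 (fun s => f s 0 j * c 0 j) (df 0 j * c 0 j).
  have [d1 d2] := fd j; have d3 : is_derive t 1 (fun s => f s 0 j) (df 0 j).
    by apply: DeriveDef => //; rewrite -derive1E.
  rewrite (_ : (fun s => _) = c 0 j *: (fun s => f s 0 j)); last first.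
    by apply/funext => s; rewrite /GRing.scale /= mulrC.
  by rewrite mulrC; apply: is_deriveZ.
have := is_derive_sum H.
by rewrite (_ : \sum_(i < k) _ = fun s => \sum_(i < k) f s 0 i * c 0 i) // fct_sumE.
Qed.

Lemma measurable_enorm (D : set R) k (u : R -> 'rV[R]_k) : measurable D ->
  (forall j, measurable_fun D (fun t => u t 0 j)) ->
  measurable_fun D (fun t => enorm (u t)).
Proof.
move=> mD um; apply: (@measurableT_comp _ _ _ _ _ _ (@Num.sqrt R)).
  exact: continuous_measurable_fun (@sqrt_continuous R).
by apply: measurable_sum => i; apply: measurable_funX.
Qed.

Section Curve.
Context p q gamma u (L e : R).
Hypothesis adm : admissible B p q gamma u.
Hypothesis uL : ctrl_length u = L%:E.
Hypothesis e0 : 0 < e.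

(** Adding [e * t] to the arclength makes it strictly increasing even where the control vanishes, so
    that nodes at equal increments of [F] are well ordered. *)
Lemma arclength_primitive : exists F : R -> R, [/\ F 0 = 0, F 1 = L + e,
    forall a b, 0 <= a -> a < b -> b <= 1 -> F a < F b,
    {within `[0, 1]%classic, continuous F} &
    {ae mu, forall t, t \in `]0, 1[%R ->
       derivable F t 1 /\ enorm (u t) <= derive1 F t}].
Proof.
case: adm => _ _ um _.
have [F [F0 F1 Fm Fc Fd]] := primitive (measurable_enorm (measurable_itv _) um)
  (fun t => enorm_ge0 (u t)) uL.
exists (fun t => F t + e * t); split.
- by rewrite F0 mulr0 addr0.
- by rewrite F1 mulr1.
- move=> a b a0 ab b1; have := Fm a b a0 (ltW ab) b1.
  have : e * a < e * b by rewrite ltr_pM2l.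
  lra.
- apply: (@within_continuousD _ R R^o) => //; apply: continuous_subspaceT.
  exact: mulrl_continuous.
- move: Fd; apply: filterS; first exact: (ae_filter_ringOfSetsType mu).
  move=> t H t01; have [dF F't] := H t01.
  have dE : is_derive t 1 (fun s => F s + e * s) (enorm (u t) + e).
    have d1 : is_derive t 1 F (enorm (u t)) by apply: DeriveDef => //; rewrite -derive1E.
    have d2 : is_derive t 1 (fun s : R => e * s) e.
      by have := @is_deriveZ R R^o R^o id e t 1 1 _; rewrite /GRing.scale /= mulr1; apply.
    exact: is_deriveD.
  split; first exact: ex_derive.
  by rewrite derive1E derive_val lerDl ltW.
Qed.

Section Estimates.
Context (F : R -> R).
Hypothesis Fmono : forall a b, 0 <= a -> a < b -> b <= 1 -> F a < F b.
Hypothesis Fd : {ae mu, forall t, t \in `]0, 1[%R ->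
       derivable F t 1 /\ enorm (u t) <= derive1 F t}.

Let Fmono_le a b : 0 <= a -> a <= b -> b <= 1 -> F a <= F b.
Proof. by rewrite [a <= b]le_eqVlt => a0 /predU1P[->//|ab] b1; apply/ltW/Fmono. Qed.

(** Vector increments are estimated by duality: every linear functional of the two layers is a
    scalar absolutely continuous function, to which the comparison with [F] applies. *)
Lemma linear_increment_le (c : 'rV[R]_m) (d : 'rV[R]_n2) (K a b : R) :
  0 <= K -> 0 <= a -> a <= b -> b <= 1 ->
  (forall t, a <= t -> t <= b ->
     dotp (u t) c + dotp (B (gamma t).1 (u t)) d <= K * enorm (u t)) ->
  (dotp (gamma b).1 c + dotp (gamma b).2 d) - (dotp (gamma a).1 c + dotp (gamma a).2 d)
    <= K * (F b - F a).
Proof.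
move=> K0 a0 ab b1 H; rewrite mulrBr.
case: adm => _ [ac1 ac2] _ ode.
apply: (abs_cont01_increment_le (f := fun t => dotp (gamma t).1 c + dotp (gamma t).2 d)
  (F := fun t => K * F t)) => //.
- have acd k (f : R -> 'rV[R]_k) (v : 'rV[R]_k) :
      (forall j, abs_cont01 (fun t => f t 0 j)) -> abs_cont01 (fun t => dotp (f t) v).
    move=> fc; under eq_fun do rewrite dotpC.
    exact: (abs_cont01_sum _ (fun j => abs_cont01Z (v 0 j) (fc j))).
  exact: (abs_cont01D (acd _ _ c ac1) (acd _ _ d ac2)).
- move=> x y ax xy yb; rewrite ler_wpM2l //; apply: Fmono_le => //; lra.
- have aeF := ae_filter_ringOfSetsType mu.
  apply: (@filterS _ _ aeF _ _ _ (filterI Fd ode)) => t [Ft odet] /[!in_itv] /= /andP[at_ tb].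
  have t01 : t \in `]0, 1[%R by rewrite in_itv /=; apply/andP; split; lra.
  have [dF uF] := Ft t01; have [d1 d2] := odet t01.
  have D1 := is_derive_dotp c d1; have D2 := is_derive_dotp d d2.
  have D12 := is_deriveD D1 D2.
  have DF : is_derive t 1 (fun s => K * F s) (K * derive1 F t).
    have DF : is_derive t 1 F (derive1 F t) by apply: DeriveDef => //; rewrite -derive1E.
    exact: (is_deriveZ K DF).
  split; [exact: ex_derive | exact: ex_derive |].
  rewrite !derive1E (@derive_val _ _ _ _ _ _ _ DF) (@derive_val _ _ _ _ _ _ _ D12).
  by apply: le_trans (H _ (ltW at_) (ltW tb)) _; rewrite ler_wpM2l.
Qed.

Lemma curve_increment1 a b : 0 <= a -> a <= b -> b <= 1 ->
  enorm ((gamma b).1 - (gamma a).1) <= F b - F a.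
Proof.
move=> a0 ab b1; set v := _ - _; have Fab := Fmono_le a0 ab b1.
have [v0|v0] := eqVneq (enorm v) 0; first by rewrite v0; lra.
have vp : 0 < enorm v by rewrite lt_neqAle eq_sym v0 enorm_ge0.
rewrite -(ler_pM2l vp) -expr2 enorm2E {1}/v dotpDl dotpNl.
have := @linear_increment_le v 0 (enorm v) a b (enorm_ge0 _) a0 ab b1.
rewrite !(dotpC _ 0) !dotp0l !addr0; apply => t _ _.
by rewrite (dotpC _ 0) dotp0l addr0 mulrC dotp_le.
Qed.

(* Apply the mean value inequality to the left translate of the curve by
   [gamma a], whose second layer has derivative [B (gamma1 - gamma1 a, u)]. *)
Lemma curve_increment2 a b : 0 <= a -> a <= b -> b <= 1 ->
  enorm ((gamma b).2 - (gamma a).2 - B (gamma a).1 ((gamma b).1 - (gamma a).1))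
    <= skew_bound B * (F b - F a) ^+ 2.
Proof.
move=> a0 ab b1; set v := _ - _ - _; have Fab := Fmono_le a0 ab b1.
have F0 : 0 <= F b - F a by lra.
have [v0|v0] := eqVneq (enorm v) 0.
  by rewrite v0 mulr_ge0 ?skew_bound_ge0 ?sqr_ge0.
have vp : 0 < enorm v by rewrite lt_neqAle eq_sym v0 enorm_ge0.
(* Represents [x |-> - dotp (B (gamma a).1 x) v], the part that the left translation adds to the
   functional [v] on the second layer. *)
pose c : 'rV[R]_m := \row_i (- dotp (B (gamma a).1 (delta_mx 0 i)) v).
have cE x : dotp x c = - dotp (B (gamma a).1 x) v.
  rewrite [in RHS](row_sum_delta x) (skew_sumr B_skew).
  have dotp_suml (f : 'I_m -> 'rV[R]_n2) : dotp (\sum_i f i) v = \sum_i dotp (f i) v.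
    by elim/big_rec2: _ => [|i y z _ <-]; rewrite ?dotpDl ?dotp0l.
  rewrite dotp_suml -sumrN; apply: eq_bigr => i _.
  by rewrite mxE (skewZr B_skew) dotpZl mulrN.
rewrite -(ler_pM2l vp) -expr2 enorm2E {1}/v.
have := @linear_increment_le c v (enorm v * (skew_bound B * (F b - F a))) a b _ a0 ab b1.
rewrite !cE (skewDr B_skew) (skewNr B_skew) !(dotpDl, dotpNl).
have -> : enorm v * (skew_bound B * (F b - F a)) * (F b - F a) =
  enorm v * (skew_bound B * (F b - F a) ^+ 2) by ring.
move=> H; apply: le_trans (H _ _); first by lra.
  by rewrite !mulr_ge0 ?skew_bound_ge0 // ltW.
move=> t at_ tb; rewrite cE addrC -dotpNl -dotpDl -(skewNl B_skew) -(skewDl B_skew).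
apply: le_trans (dotp_le _ _) _; rewrite mulrC -mulrA ler_wpM2l ?enorm_ge0 //.
apply: le_trans (enorm_skew_le B_skew _ _) _.
rewrite -mulrA ler_wpM2l ?skew_bound_ge0 // ler_wpM2r ?enorm_ge0 //.
apply: le_trans (curve_increment1 a0 at_ _) _; first by lra.
by rewrite lerD2r; apply: Fmono_le => //; lra.
Qed.

End Estimates.

(** Nodes are placed by the intermediate value theorem at equal increments of [F]. Every chord is
    then at most [(L + e) / N], and every second-layer error at most [skew_bound B] times its
    square. *)
Lemma almost_reached_of_admissible : almost_reached B (ginv p ** q) (L + e).
Proof.
have [F [F0 F1 Fmono Fc Fd]] := arclength_primitive.
have Le0 : 0 < L + e by rewrite -F1 -F0; apply: Fmono.
exists (skew_bound B * (L + e) ^+ 2).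
  by rewrite mulr_ge0 ?skew_bound_ge0 ?sqr_ge0.
move=> N N0; have NR : 0 < N%:R :> R by rewrite ltr0n.
have /choice[s sP] : forall i : nat, exists s, (i <= N)%N ->
    s \in `[0, 1]%R /\ F s = i%:R / N%:R * (L + e).
  move=> i; have [iN|] := leqP i N; last by exists 0.
  have i1 : i%:R / N%:R <= 1 :> R by rewrite ler_pdivrMr // mul1r ler_nat.
  have i0 : 0 <= i%:R / N%:R :> R by rewrite divr_ge0.
  have [|s s01 Fs] := @IVT R F 0 1 (i%:R / N%:R * (L + e)) ler01 Fc.
    rewrite F0 F1 ge_min le_max mulr_ge0 ?(ltW Le0) //=.
    by rewrite ler_piMl ?orbT // ltW.
  by exists s.
have s0 i : (i <= N)%N -> 0 <= s i.
  by move=> /sP[]; rewrite in_itv /= => /andP[].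
have s1 i : (i <= N)%N -> s i <= 1.
  by move=> /sP[]; rewrite in_itv /= => /andP[].
have sF i : (i <= N)%N -> F (s i) = i%:R / N%:R * (L + e) by move=> /sP[].
have s_mono x y : 0 <= x -> x <= 1 -> 0 <= y -> y <= 1 -> F x <= F y -> x <= y.
  by move=> x0 x1 y0 y1 Fxy; rewrite leNgt; apply/negP => /Fmono-/(_ y0 x1); lra.
have s_eq x y : 0 <= x -> x <= 1 -> 0 <= y -> y <= 1 -> F x = F y -> x = y.
  move=> x0 x1 y0 y1 Fxy; apply/eqP; rewrite eq_le.
  by apply/andP; split; apply: s_mono => //; rewrite Fxy.
have sS i : (i < N)%N -> s i <= s i.+1.
  move=> iN; have iN' := ltnW iN; apply: s_mono; rewrite ?s0 ?s1 ?sF //.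
  by rewrite ler_pM2r // ler_pM2r ?invr_gt0 // ler_nat.
have FS i : (i < N)%N -> F (s i.+1) - F (s i) = (L + e) / N%:R.
  by move=> iN; rewrite !sF ?(ltnW iN) // -natr1; field; rewrite gt_eqF.
have s00 : s 0%N = 0 by apply: s_eq; rewrite ?s0 ?s1 ?sF // mul0r mul0r.
have sN1 : s N = 1 by apply: s_eq; rewrite ?s0 ?s1 ?sF // F1 divff ?mul1r // gt_eqF.
pose w i := (gamma (s i.+1)).1 - (gamma (s i)).1.
pose r i := (gamma (s i.+1)).2 - (gamma (s i)).2 - B (gamma (s i)).1 (w i).
(* The polygon starts at the identity, so its vertices follow the curve translated by the inverse of
   [gamma (s 0)], up to the accumulated errors [r]. *)
have wE n : pth B w n = ((gamma (s n)).1 - (gamma (s 0%N)).1,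
    (gamma (s n)).2 - (gamma (s 0%N)).2
    - B (gamma (s 0%N)).1 ((gamma (s n)).1 - (gamma (s 0%N)).1) - \sum_(i < n) r i).
  elim: n => [|n IH]; first by rewrite big_ord0 !subrr (skew0r B_skew) !subr0.
  rewrite /= IH /gmul /= big_ord_recr /= /r /w !(skewE B_skew).
  by congr pair; apply/rowP => i; rewrite !mxE; ring.
exists w; case: adm => -[g0 g1] _ _ _.
have w2E : (pth B w N).2 - (ginv p ** q).2 = - \sum_(i < N) r i.
  rewrite wE s00 sN1 g0 g1 /= !(skewE B_skew).
  by apply/rowP => i; rewrite !mxE; ring.
split.
- move=> i iN; rewrite /w -(FS i iN).
  by apply: (curve_increment1 Fmono Fd); rewrite ?s0 ?s1 ?sS // ltnW.
- by rewrite wE s00 sN1 g0 g1 /= addrC.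
- rewrite w2E enormN; apply: le_trans (enorm_sum _ _ _) _.
  apply: (@le_trans _ _ (\sum_(i < N) skew_bound B * ((L + e) / N%:R) ^+ 2)).
    apply: ler_sum => i _; rewrite -(FS i (ltn_ord i)).
    by apply: (curve_increment2 Fmono Fd); rewrite ?s0 ?s1 ?sS // ltnW.
  rewrite sumr_const card_ord -mulr_natr le_eqVlt; apply/orP; left; apply/eqP.
  by field; rewrite gt_eqF.
Qed.

End Curve.
End AdmissibleToPolygon.

(** * Polygons as admissible curves, and equality of the two distances *)

Section PolygonToAdmissible.
Context (R : realType) (m n2 : nat).
Context (B : 'rV[R]_m -> 'rV[R]_m -> 'rV[R]_n2) (B_skew : skew_bilinear B).
Local Notation G := (carnot_pt R m n2).
Local Notation mu := (@lebesgue_measure R).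
Local Notation "p ** q" := (gmul B p q) (at level 40, left associativity).

Lemma abs_cont01_lipschitz (f : R -> R) (K : R) : 0 <= K ->
  (forall s t, `|f s - f t| <= K * `|s - t|) -> abs_cont01 f.
Proof.
move=> K0 fK e e0; have K1 : 0 < K + 1 by rewrite ltr_wpDl.
exists (e / (K + 1)); first by rewrite divr_gt0.
move=> k a b ab1 _; rewrite ltr_pdivlMr // mulrC; apply: le_lt_trans.
rewrite mulr_sumr; apply: ler_sum => i _; apply: le_trans (fK _ _) _.
have [_ [ab _]] := ab1 i (ltn_ord i).
by rewrite ger0_norm ?subr_ge0 // ler_wpM2r ?subr_ge0 // lerDl.
Qed.

Definition clamp (x : R) : R := if x <= 0 then 0 else if 1 <= x then 1 else x.

Lemma clamp_lipschitz x y : `|clamp x - clamp y| <= `|x - y|.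
Proof.
rewrite ler_norml /clamp; have := ler_norm (x - y); have := ler_norm (y - x).
rewrite (distrC y x); set d := `|x - y| => h1 h2.
by do !case: ifPn; rewrite -?ltNge => *; apply/andP; split; lra.
Qed.

Section Polygon.
Context (p : G) (w : nat -> 'rV[R]_m) (N : nat).

Definition node (i : nat) : R := i%:R / N%:R.
Definition ramp (i : nat) (t : R) : R := clamp (N%:R * t - i%:R).
Definition rate (i : nat) (t : R) : R := N%:R * \1_(`]node i, node i.+1[%classic : set R) t.

Lemma ramp_lipschitz i s t : `|ramp i s - ramp i t| <= N%:R * `|s - t|.
Proof.
apply: le_trans (clamp_lipschitz _ _) _.
by rewrite opprB addrA subrK -mulrBr normrM normr_nat.
Qed.

Lemma nodeE i t : (0 < N)%N ->
  ((t < node i) = (N%:R * t - i%:R < 0)) * ((node i < t) = (0 < N%:R * t - i%:R)).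
Proof.
move=> N0; have NR : 0 < N%:R :> R by rewrite ltr0n.
by rewrite /node subr_lt0 subr_gt0 ltr_pdivlMr // ltr_pdivrMr // mulrC.
Qed.

Lemma is_derive_ramp i t : (0 < N)%N -> t != node i -> t != node i.+1 ->
  is_derive t 1 (ramp i) (rate i t).
Proof.
move=> N0 ti tS; rewrite /rate indicE mem_setE in_itv /=.
have [lti|lti|E] := ltgtP t (node i); last by rewrite E eqxx in ti.
  rewrite mulr0; apply: (near_eq_is_derive _ (@is_derive_cst R R^o R^o 0 t 1)).
  have := lt_nbhsl lti; apply: filterS => s; rewrite (nodeE i s N0) /ramp /clamp.
  by move=> /ltW ->.
have [ltS|ltS|E] := ltgtP t (node i.+1); last by rewrite E eqxx in tS.
  rewrite mulr1; have d : is_derive t 1 (fun s => N%:R * s - i%:R) N%:R.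
    have d1 : is_derive t 1 (fun s : R => N%:R * s) N%:R.
      by have := @is_deriveZ R R^o R^o id N%:R t 1 1 _; rewrite /GRing.scale /= mulr1; apply.
    have := @is_deriveD R R^o R^o _ _ t 1 _ _ d1 (@is_derive_cst R R^o R^o (- i%:R) t 1).
    by rewrite addr0.
  apply: (near_eq_is_derive _ d); near=> s; rewrite /ramp /clamp.
  have : node i < s by near: s; exact: lt_nbhsr.
  have : s < node i.+1 by near: s; exact: lt_nbhsl.
  rewrite (nodeE i.+1 s N0) (nodeE i s N0) -natr1 => h1 h2.
  by rewrite leNgt h2 /= leNgt (_ : N%:R * s - i%:R < 1) //; lra.
rewrite mulr0; apply: (near_eq_is_derive _ (@is_derive_cst R R^o R^o 1 t 1)).
have := lt_nbhsr ltS; apply: filterS => s; rewrite (nodeE i.+1 s N0) /ramp /clamp -natr1 => h.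
rewrite (_ : (N%:R * s - i%:R <= 0) = false); last by apply/negbTE; rewrite -ltNge; lra.
by rewrite (_ : 1 <= N%:R * s - i%:R) //; lra.
Unshelve. all: by end_near. Qed.

(** A sum of ramps, so that absolute continuity and derivatives are obtained termwise. The second
    layer uses the fixed vertex [(pth B w j).1] on each edge instead of the moving point. *)
Definition polycurve (t : R) : G :=
  (p.1 + \sum_(i < N) ramp i t *: w i,
   p.2 + \sum_(j < N) ramp j t *: B (p.1 + (pth B w j).1) (w j)).

Definition polycontrol (t : R) : 'rV[R]_m := \sum_(i < N) rate i t *: w i.

Lemma ramp0 i : ramp i 0 = 0.
Proof. by rewrite /ramp /clamp mulr0 sub0r oppr_le0 ler0n. Qed.

Lemma ramp1 i : (i < N)%N -> ramp i 1 = 1.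
Proof.
move=> iN; have : i.+1%:R <= N%:R :> R by rewrite ler_nat.
rewrite /ramp /clamp mulr1 -natr1 => h.
rewrite (_ : (N%:R - i%:R <= 0) = false); last by apply/negbTE; rewrite -ltNge; lra.
by rewrite (_ : 1 <= N%:R - i%:R) //; lra.
Qed.

Lemma gmul_pthE n : p ** pth B w n =
  (p.1 + \sum_(i < n) w i, p.2 + \sum_(j < n) B (p.1 + (pth B w j).1) (w j)).
Proof.
elim: n => [|n IH]; first by rewrite (gmul0r B_skew) !big_ord0 !addr0; case: p.
rewrite /= (gmulA B_skew) IH /gmul /= addr0 !big_ord_recr /= -!addrA.
by rewrite (pth1E B w n).
Qed.

Lemma rate_neq0 j t : rate j t != 0 ->
  [/\ (0 < N)%N, j%:R < N%:R * t & N%:R * t < j.+1%:R].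
Proof.
rewrite /rate indicE mem_setE in_itv /= mulf_eq0 negb_or pnatr_eq0 -lt0n => /andP[N0].
rewrite (nodeE j t N0) (nodeE j.+1 t N0) subr_gt0 subr_lt0.
by case: andP => [[]|]; rewrite ?eqxx.
Qed.

Lemma rate_ramp i j t : rate j t != 0 -> i != j -> ramp i t = (i < j)%:R.
Proof.
move=> /rate_neq0[N0 jt tj]; rewrite neq_ltn /ramp /clamp => /orP[ij|ji].
  rewrite ij; have : i.+1%:R <= j%:R :> R by rewrite ler_nat.
  rewrite -natr1 => h.
  rewrite (_ : (N%:R * t - i%:R <= 0) = false); last by apply/negbTE; rewrite -ltNge; lra.
  by rewrite (_ : 1 <= N%:R * t - i%:R) //; lra.
rewrite ltnNge (ltnW ji) /=; have : j.+1%:R <= i%:R :> R by rewrite ler_nat.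
by move=> h; rewrite (_ : N%:R * t - i%:R <= 0) //; lra.
Qed.

(** While edge [j] is traversed, the moving point differs from vertex [j] by a multiple of [w j],
    which [B _ (w j)] kills; at other times [rate j t] is 0. *)
Lemma skew_polycurve j t : (j < N)%N ->
  rate j t *: B (p.1 + (pth B w j).1) (w j) = rate j t *: B (polycurve t).1 (w j).
Proof.
move=> jN; have [->|r0] := eqVneq (rate j t) 0; first by rewrite !scale0r.
congr (_ *: _); rewrite /polycurve /=.
have -> : \sum_(i < N) ramp i t *: w i = (pth B w j).1 + ramp j t *: w j.
  rewrite pth1E (big_ord_widen N (fun i => w i) (ltnW jN)) [in RHS]big_mkcond /=.
  rewrite (bigD1 (Ordinal jN)) //= [in RHS](bigD1 (Ordinal jN)) //= ltnn add0r addrC.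
  congr (_ + _); apply: eq_bigr => i ine.
  have ij : (i : nat) != j by apply: contraNneq ine => E; apply/eqP/val_inj.
  by rewrite (rate_ramp r0 ij); case: ifP => _; rewrite ?scale1r ?scale0r.
by rewrite addrA (skewDl B_skew _ (ramp j t *: w j)) (skewZl B_skew) (skewxx B_skew) scaler0 addr0.
Qed.

Lemma polycurve_derivable (b : nat -> R) (a : R) t : (forall i, (i <= N)%N -> t != node i) ->
  is_derive t 1 (fun s => a + \sum_(i < N) ramp i s * b i) (\sum_(i < N) rate i t * b i).
Proof.
move=> tn.
have H (i : 'I_N) : is_derive t 1 (fun s => ramp i s * b i) (rate i t * b i).
  have N0 : (0 < N)%N by apply: leq_ltn_trans (ltn_ord i).
  have d := is_derive_ramp N0 (tn i (ltnW (ltn_ord i))) (tn i.+1 (ltn_ord i)).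
  rewrite (_ : (fun s => _) = b i *: ramp i); last first.
    by apply/funext => s; rewrite /GRing.scale /= mulrC.
  by rewrite mulrC; apply: is_deriveZ.
have := is_derive_sum H.
rewrite (_ : \sum_(i < N) _ = fun s => \sum_(i < N) ramp i s * b i); last by rewrite fct_sumE.
move=> d; have := @is_deriveD R R^o R^o _ _ t 1 _ _ (@is_derive_cst R R^o R^o a t 1) d.
by rewrite add0r.
Qed.

Lemma polycurve_abs_cont (b : nat -> R) (a : R) :
  abs_cont01 (fun s => a + \sum_(i < N) ramp i s * b i).
Proof.
apply: (@abs_cont01_lipschitz _ (\sum_(i < N) N%:R * `|b i|)).
  by rewrite sumr_ge0 // => i _; rewrite mulr_ge0.
move=> s t; rewrite opprD addrACA subrr add0r -sumrB mulr_suml.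
apply: le_trans (ler_norm_sum _ _ _) _; apply: ler_sum => i _.
by rewrite -mulrBl normrM mulrAC ler_wpM2r // ramp_lipschitz.
Qed.

Lemma measurable_rate (D : set R) i : measurable D -> measurable_fun D (rate i).
Proof.
move=> mD; apply: measurable_funM; first exact: measurable_cst.
by apply: measurable_indic; exact: measurable_itv.
Qed.

Lemma rate_ge0 i t : 0 <= rate i t.
Proof. by rewrite mulr_ge0 // indicE. Qed.

Lemma integral_rate i : (i < N)%N ->
  (\int[mu]_(t in (`[0%R, 1%R]%classic : set R)) (rate i t)%:E = 1%E)%E.
Proof.
move=> iN; have N0 : (0 < N)%N by apply: leq_ltn_trans iN.
have NR : 0 < N%:R :> R by rewrite ltr0n.
have mI := measurable_itv `[(0:R), 1].
have mn := measurable_itv `](node i), (node i.+1)[.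
under eq_integral do rewrite EFinM.
rewrite ge0_integralZl ?lee_fin //; last first.
  by apply/measurable_EFinP; apply: measurable_indic.
have muE : mu `](node i), (node i.+1)[%classic = (N%:R^-1)%:E.
  rewrite lebesgue_measure_itv /= lte_fin ltr_pM2r ?invr_gt0 // ltr_nat ltnSn.
  by rewrite -EFinD /node -natr1; congr (_%:E); field; rewrite gt_eqF.
transitivity (N%:R%:E * mu `](node i), (node i.+1)[%classic)%E; last first.
  by rewrite muE -EFinM mulfV // gt_eqF.
rewrite integral_indic // setIidl // => t; rewrite /= !in_itv /= => /andP[t1 t2].
apply/andP; split; first by apply: le_trans (ltW t1); rewrite divr_ge0.
by apply: le_trans (ltW t2) _; rewrite /node ler_pdivrMr // mul1r ler_nat.
Qed.

Lemma polycurve_admissible : admissible B p (p ** pth B w N) polycurve polycontrol.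
Proof.
have e1 j : (fun t => (polycurve t).1 0 j) = (fun t => p.1 0 j + \sum_(i < N) ramp i t * w i 0 j).
  apply/funext => t; rewrite /polycurve /= mxE summxE; congr (_ + _).
  by apply: eq_bigr => i _; rewrite mxE.
have e2 j : (fun t => (polycurve t).2 0 j) =
    (fun t => p.2 0 j + \sum_(i < N) ramp i t * B (p.1 + (pth B w i).1) (w i) 0 j).
  apply/funext => t; rewrite /polycurve /= mxE summxE; congr (_ + _).
  by apply: eq_bigr => i _; rewrite mxE.
split.
- rewrite gmul_pthE /polycurve; split.
    by rewrite !big1 ?addr0; [case: p | move=> i _; rewrite ramp0 scale0r ..].
  by congr (_ + _, _ + _); apply: eq_bigr => i _; rewrite ramp1 // scale1r.
- split=> j; first by rewrite e1; exact: (polycurve_abs_cont (fun i => w i 0 j)).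
  rewrite e2.
  exact: (polycurve_abs_cont (fun i => B (p.1 + (pth B w i).1) (w i) 0 j)).
- move=> j; rewrite (_ : (fun t => _) = (fun t => \sum_(i < N) rate i t * w i 0 j)).
    apply: measurable_sum => i; apply: measurable_funM; last exact: measurable_cst.
    by apply: measurable_rate; exact: measurable_itv.
  by apply/funext => t; rewrite summxE; apply: eq_bigr => i _; rewrite mxE.
- exists [set node i | i in `I_N.+1]; split.
  + apply: countable_measurable; first by move=> t; exact: measurable_set1.
    by apply: finite_set_countable; apply: finite_image; exact: finite_II.
  + apply: countable_lebesgue_measure0; apply: finite_set_countable.
    by apply: finite_image; exact: finite_II.
  + move=> t /= H; apply: contrapT => tn; apply: H => _.
    have tn' i : (i <= N)%N -> t != node i.
      by move=> iN; apply/eqP => E; apply: tn; exists i.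
    split=> j.
      have := polycurve_derivable (fun i => w i 0 j) (p.1 0 j) tn'.
      rewrite -e1 => d; split; first exact: ex_derive.
      rewrite derive1E derive_val summxE; apply: eq_bigr => i _; by rewrite mxE.
    have := polycurve_derivable (fun i => B (p.1 + (pth B w i).1) (w i) 0 j) (p.2 0 j) tn'.
    rewrite -e2 => d; split; first exact: ex_derive.
    rewrite derive1E derive_val /polycontrol (skew_sumr B_skew) summxE.
    apply: eq_bigr => i _; rewrite (skewZr B_skew) -skew_polycurve //.
    by rewrite mxE.
Qed.

Lemma ctrl_length_polycontrol : (ctrl_length polycontrol <= (plen w N)%:E)%E.
Proof.
have mI := measurable_itv `[(0:R), 1].
have mr (i : nat) : measurable_fun (`[0%R, 1%R]%classic : set R)
    (fun t => (rate i t * enorm (w i))%:E).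
  apply/measurable_EFinP; apply: measurable_funM; last exact: measurable_cst.
  exact: measurable_rate.
have r0 (i : nat) t : (0 <= (rate i t * enorm (w i))%:E)%E.
  by rewrite lee_fin mulr_ge0 ?rate_ge0 ?enorm_ge0.
apply: (@le_trans _ _ (\int[mu]_(t in (`[0%R, 1%R]%classic : set R))
    (\sum_(i < N) (rate i t * enorm (w i))%:E)%R)%E).
  apply: ge0_le_integral => //.
  - by move=> t _; rewrite lee_fin enorm_ge0.
  - apply/measurable_EFinP; apply: measurable_enorm => // j.
    by case: polycurve_admissible => _ _ um _; exact: um.
  - by apply: emeasurable_sum => i; exact: (mr i).
  - move=> t _; rewrite sumEFin lee_fin; apply: le_trans (enorm_sum _ _ _) _.
    by apply: ler_sum => i _; rewrite enormZ ger0_norm ?rate_ge0.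
rewrite ge0_integral_sum //; last by move=> i; exact: (mr i).
rewrite /plen -sumEFin; apply: lee_sum => i _.
under eq_integral do rewrite EFinM.
rewrite ge0_integralZr ?integral_rate ?mul1e ?lee_fin ?enorm_ge0 //.
  by apply/measurable_EFinP; exact: measurable_rate.
by move=> t _; rewrite lee_fin rate_ge0.
Qed.

End Polygon.

Context (B_span : B_spanning B).
Local Notation D := (polydist B).

Lemma polydist_le_of_almost_reached p L : 0 <= L -> almost_reached B p L -> D p <= L.
Proof.
move=> L0 [C C0 pL]; apply/ler_addgt0Pr => e e0.
have [d d0 H] := polydist_continuous B_skew B_span p e0.
set N := (Num.bound (C / d)).+1.
have NR : 0 < N%:R :> R by rewrite ltr0n.
have CN : C / N%:R <= d.
  rewrite ler_pdivrMr // -ler_pdivrMl // mulrC; apply: ltW.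
  apply: lt_trans (archi_boundP _) _; first by rewrite divr_ge0 // ltW.
  by rewrite ltr_nat.
have [w [w1 w2 w3]] := pL N (ltn0Sn _).
rewrite (_ : p = pth B w N ** (ginv (pth B w N) ** p)); last first.
  by rewrite (gmulA B_skew) (gmulVr B_skew) (gmul0l B_skew).
apply: le_trans (polydistM B_skew B_span _ _) _; apply: lerD; last first.
  by apply: H; [rewrite w2 subrr enorm0 ltW | rewrite enormB (le_trans w3)].
apply: le_trans (polydist_le _ _ _) _; rewrite /plen.
apply: (@le_trans _ _ (\sum_(i < N) L / N%:R)); first by apply: ler_sum => i _; exact: w1.
by rewrite sumr_const card_ord -(mulr_natr (L / N%:R) N) divfK // gt_eqF.
Qed.

Lemma ctrl_length_ge0 (u : R -> 'rV[R]_m) : (0 <= ctrl_length u)%E.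
Proof. by apply: integral_ge0 => t _; rewrite lee_fin enorm_ge0. Qed.

(** Since [ccdist] takes [fine] of an extended infimum, finiteness comes first: [D] bounds it from
    below and a single polygon from above. *)
Lemma ccdistE p q : ccdist B p q = D (ginv p ** q).
Proof.
rewrite /ccdist; set S := [set _ | _].
have lb : ((D (ginv p ** q))%:E <= ereal_inf S)%E.
  apply/ereal_infP => _ [gamma [u [adm ->]]].
  case uL : (ctrl_length u) => [L| |]; first 1 last.
  - by rewrite leey.
  - by have := ctrl_length_ge0 u; rewrite uL.
  rewrite lee_fin; apply/ler_addgt0Pr => e e0.
  have L0 : 0 <= L by have := ctrl_length_ge0 u; rewrite uL lee_fin.
  apply: polydist_le_of_almost_reached; first by rewrite addr_ge0 // ltW.
  exact: almost_reached_of_admissible adm uL e0.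
have ub w n : pth B w n = ginv p ** q -> (ereal_inf S <= (plen w n)%:E)%E.
  move=> E; apply: ge_ereal_inf; exists (ctrl_length (polycontrol w n)).
    exists (polycurve p w n), (polycontrol w n); split => //.
    have := polycurve_admissible p w n.
    by rewrite E (gmulA B_skew) (gmulVr B_skew) (gmul0l B_skew).
  exact: ctrl_length_polycontrol p w n.
have fin : ereal_inf S \is a fin_num.
  have [w [n [E _]]] : exists w n, pth B w n = ginv p ** q /\ plen w n < D (ginv p ** q) + 1.
    by apply: polydist_lt => //; rewrite ltrDl.
  rewrite fin_numE; apply/andP; split.
    by rewrite gt_eqF // (lt_le_trans _ lb) // ltNyr.
  by rewrite lt_eqF // (le_lt_trans (ub w n E)) // ltry.
apply/eqP; rewrite eq_le -!lee_fin fineK // lb andbT -[X in (X <= _)%E]fineK //.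
rewrite lee_fin; apply/ler_addgt0Pr => e e0.
have [w [n [E wn]]] : exists w n, pth B w n = ginv p ** q /\ plen w n < D (ginv p ** q) + e.
  by apply: polydist_lt => //; rewrite ltrDl.
by rewrite -lee_fin fineK // (le_trans (ub w n E)) // lee_fin ltW.
Qed.

End PolygonToAdmissible.

(** * The conjugate of a strongly convex function *)

Section Conjugate.
Context (R : realType) (Phi : R -> R).
Hypothesis Phi_nonneg : forall tau, 0 <= tau -> 0 <= Phi tau.
Hypothesis Phi_cont : {within `[0, +oo[, continuous Phi}.
Hypothesis Phi0 : Phi 0 = 0.
Hypothesis Phi_coercive : Phi tau / tau @[tau --> +oo] --> +oo.
Hypothesis Phi_convex : loc_strongly_convex (fun s => Phi `|s|).
Local Notation conj := (conjugate Phi).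

Lemma coercive_bound (S : R) : exists2 K, 0 < K & forall tau, K <= tau -> S * tau <= Phi tau.
Proof.
have /cvgryPge /(_ S) [M [_ HM]] := Phi_coercive.
exists (`|M| + 1); first by rewrite ltr_wpDl.
move=> tau Mt; have t0 : 0 < tau by apply: lt_le_trans Mt; rewrite ltr_wpDl.
by rewrite -ler_pdivlMr //; apply: HM; apply: lt_le_trans Mt; rewrite ltr_pwDr ?ler_norm.
Qed.

(** Past [K] the objective is at most 0, its value at [tau = 0]. One [K] serves all slopes [s <= S],
    which later gives a uniform Lipschitz constant and a single convexity modulus. *)
Lemma conjugate_argmax (S : R) : exists2 K, 0 < K & forall s, s <= S ->
  exists tau, [/\ 0 <= tau <= K, conj s = s * tau - Phi tau &
    forall sigma, 0 <= sigma -> s * sigma - Phi sigma <= s * tau - Phi tau].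
Proof.
have [K K0 HK] := coercive_bound S; exists K => // s sS.
have cont : {within `[0, K]%classic, continuous (fun tau => s * tau - Phi tau)}.
  have sub : (`[0, K] : set R) `<=` `[0, +oo[.
    by move=> x /=; rewrite !in_itv /= => /andP[->].
  move=> x; apply: (@within_continuousB _ R R^o _ (fun tau => s * tau) Phi).
    by apply: continuous_subspaceT; exact: mulrl_continuous.
  exact: continuous_subspaceW sub Phi_cont.
have [tau] := EVT_max (ltW K0) cont; rewrite in_itv /= => tau0K tau_max.
have ub sigma : 0 <= sigma -> s * sigma - Phi sigma <= s * tau - Phi tau.
  move=> s0; have [sK|/ltW Ks] := leP sigma K.
    by apply: tau_max; rewrite in_itv /= s0.
  have := tau_max 0; rewrite in_itv /= lexx (ltW K0) mulr0 Phi0 subr0 => /(_ isT).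
  apply: le_trans; rewrite subr_le0; apply: le_trans (HK _ Ks).
  by rewrite ler_wpM2r.
exists tau; split => //; apply/eqP; rewrite eq_le; apply/andP; split.
  apply: ge_sup; first by exists (s * 0 - Phi 0), 0 => //; rewrite /= in_itv /= lexx.
  by move=> _ [sigma + <-]; rewrite /= in_itv /= andbT => /ub.
apply: ub_le_sup; last by exists tau => //; rewrite /= in_itv /= andbT; case/andP: tau0K.
exists (s * tau - Phi tau) => _ [sigma + <-].
by rewrite /= in_itv /= andbT => /ub.
Qed.

Lemma conjugate_ge s sigma : 0 <= sigma -> s * sigma - Phi sigma <= conj s.
Proof.
move=> s0; have [K _ /(_ s (lexx s)) [tau [_ -> H]]] := conjugate_argmax s.
exact: H.
Qed.

Lemma conjugate_ge0 s : 0 <= conj s.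
Proof. by have := @conjugate_ge s 0 (lexx 0); rewrite mulr0 Phi0 subr0. Qed.

Lemma conjugate0 : conj 0 = 0.
Proof.
apply/eqP; rewrite eq_le conjugate_ge0 andbT.
have [K _ /(_ 0 (lexx 0)) [tau [/andP[t0 _] -> _]]] := conjugate_argmax 0.
by rewrite mul0r sub0r oppr_le0 Phi_nonneg.
Qed.

Lemma conjugate_mono s s' : s <= s' -> conj s <= conj s'.
Proof.
move=> ss'; have [K _ /(_ s (lexx s)) [tau [/andP[t0 _] -> _]]] := conjugate_argmax s.
by apply: le_trans (conjugate_ge s' t0); rewrite lerD2r ler_wpM2r.
Qed.

Lemma conjugate_lipschitz S : exists2 K, 0 < K &
  forall a c, c <= a -> a <= S -> conj a <= conj c + K * (a - c).
Proof.
have [K K0 HK] := conjugate_argmax S; exists K => // a c ca aS.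
have [tau [/andP[t0 tK] -> _]] := HK a aS.
have := conjugate_ge c t0.
have : (a - c) * tau <= (a - c) * K by rewrite ler_wpM2l // subr_ge0.
lra.
Qed.

(* Strong convexity of [Phi] at a maximiser [tau] of [c * sigma - Phi sigma]
   puts the conjugate below a parabola touching it at [c] with slope [tau];
   comparing with [sigma = 0] gives [tau = O(c)]. *)
Lemma conjugate_parabola S : exists2 C, 0 < C & forall c, 0 <= c <= S ->
  exists2 tau, 0 <= tau /\ C * tau <= c &
    forall a, a <= S -> conj a <= conj c + tau * (a - c) + (a - c) ^+ 2 / (4 * C).
Proof.
have [K K0 HK] := conjugate_argmax S.
have [C C0 HC] := Phi_convex (ltW K0).
have C20 : 0 < C / 2 by rewrite divr_gt0.
exists (C / 2) => // c /andP[c0 cS].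
have [tau [/andP[t0 tK] conjc tau_max]] := HK c cS.
have conv sigma : 0 <= sigma <= K ->
    C / 2 * (sigma - tau) ^+ 2 <= Phi sigma - Phi tau - c * (sigma - tau).
  move=> /andP[s0 sK]; have := HC sigma tau 2^-1.
  rewrite s0 sK t0 tK => /(_ isT isT).
  have half : (0 : R) <= (2^-1 : R) <= (1 : R) by apply/andP; split; lra.
  move=> /(_ half).
  have z0 : 0 <= 2^-1 * sigma + (1 - 2^-1) * tau by lra.
  have := tau_max _ z0; rewrite (ger0_norm s0) (ger0_norm t0) (ger0_norm z0) real_normK ?num_real //.
  set X := (sigma - tau) ^+ 2; lra.
exists tau.
  split=> //; have := conv 0; rewrite lexx (ltW K0) Phi0 => /(_ isT) H.
  have {}H : tau * (C / 2 * tau) <= tau * c.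
    by have := Phi_nonneg t0; move: H; rewrite sub0r sqrrN expr2; lra.
  have [->|tn] := eqVneq tau 0; first by rewrite mulr0.
  by rewrite ler_pM2l ?lt_neqAle ?(eq_sym 0) ?tn // in H.
move=> a aS; have [sigma [sK -> _]] := HK a aS.
have := conv sigma sK; rewrite conjc.
set x := sigma - tau; set y := a - c.
have sq : x * y <= C / 2 * x ^+ 2 + y ^+ 2 / (4 * (C / 2)).
  rewrite -subr_ge0 (_ : _ - _ = (C * x - y) ^+ 2 / (2 * C)).
    by rewrite divr_ge0 ?sqr_ge0 // mulr_ge0 // ltW.
  by field; rewrite gt_eqF.
have -> : a * sigma = c * sigma + tau * y + x * y by rewrite /x /y; ring.
have -> : c * x = c * sigma - c * tau by rewrite /x; ring.
lra.
Qed.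

(** Adding two parabolas leaves the first-order term [tau * (a + b - 2 c)]. If it is positive,
    [C * tau <= c] reduces it to [c * (a + b - 2 c)], which the hypothesis on squares bounds by
    [e / 2]. *)
Lemma conjugate_semiconcave S : exists2 k, 0 <= k & forall a b c e,
  0 <= e -> a <= S -> b <= S -> 0 <= c <= S -> a ^+ 2 + b ^+ 2 <= 2 * c ^+ 2 + e ->
  conj a + conj b - 2 * conj c <= k * (e + (a - c) ^+ 2 + (b - c) ^+ 2).
Proof.
have [C C0 HC] := conjugate_parabola S.
exists C^-1; first by rewrite invr_ge0 ltW.
move=> a b c e e0 aS bS cS abc; have [tau [t0 tc] H] := HC c cS.
have := H a aS; have := H b bS.
set x := a - c; set y := b - c.
have c0 : 0 <= c by case/andP: cS.
have first_order : tau * (x + y) <= e / (2 * C).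
  have [xy|/ltW xy] := leP 0 (x + y); last first.
    by apply: (@le_trans _ _ 0); rewrite ?mulr_ge0_le0 // divr_ge0 // mulr_ge0 // ltW.
  rewrite ler_pdivlMr ?mulr_gt0 //.
  have : C * tau * (x + y) <= c * (x + y) by rewrite ler_wpM2r.
  have : 2 * (c * (x + y)) = a ^+ 2 + b ^+ 2 - 2 * c ^+ 2 - x ^+ 2 - y ^+ 2.
    by rewrite /x /y; ring.
  have := sqr_ge0 x; have := sqr_ge0 y; set x2 := x ^+ 2; set y2 := y ^+ 2; lra.
have split_inv (z : R) : z / (4 * C) = C^-1 * z / 4 by field; rewrite gt_eqF.
have split_inv' : e / (2 * C) = C^-1 * e / 2 by field; rewrite gt_eqF.
rewrite !split_inv; rewrite split_inv' in first_order.
have Ci : 0 <= C^-1 by rewrite invr_ge0 ltW.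
have := mulr_ge0 Ci (sqr_ge0 x); have := mulr_ge0 Ci (sqr_ge0 y); have := mulr_ge0 Ci e0.
lra.
Qed.

End Conjugate.

(** * The Hopf-Lax function *)

Section HopfLax.
Context (R : realType) (m n2 : nat).
Context (B : 'rV[R]_m.+1 -> 'rV[R]_m.+1 -> 'rV[R]_n2).
Context (B_skew : skew_bilinear B) (B_span : B_spanning B).
Local Notation G := (carnot_pt R m.+1 n2).
Local Notation D := (polydist B).
Local Notation "p ** q" := (gmul B p q) (at level 40, left associativity).
Implicit Types (p q : G) (h : 'rV[R]_m.+1).

(** A nearly optimal polygon may have very unequal edges. Viewing it as an admissible curve and
    discretising again yields polygons with edges at most [L / N]. *)
Lemma polydist_semiconcave p h :
  D (p ** hor n2 h) ^+ 2 + D (p ** hor n2 (- h)) ^+ 2 <=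
    2 * D p ^+ 2 + semiconcavity_bound R m * enorm h ^+ 2.
Proof.
apply/ler_addgt0Pr => eta eta0; have D0 := polydist_ge0 B p.
set d := Num.min 1 (eta / (2 * (2 * D p + 1))).
have c0 : 0 < 2 * (2 * D p + 1) by lra.
have d0 : 0 < d by rewrite lt_min ltr01 divr_gt0.
have d1 : d <= 1 by rewrite ge_min lexx.
have d2 : d * (2 * (2 * D p + 1)) <= eta.
  by rewrite -ler_pdivlMr // ge_min lexx orbT.
have [w [n [E wn]]] : exists w n, pth B w n = p /\ plen w n < D p + d / 2.
  by apply: polydist_lt => //; rewrite ltrDl divr_gt0.
have adm := polycurve_admissible B_skew (0, 0) w n.
have le := ctrl_length_polycontrol B_skew (0, 0) w n.
have ge := @ctrl_length_ge0 R m.+1 (polycontrol w n).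
case L : (ctrl_length (polycontrol w n)) le ge => [l| |] //.
rewrite !lee_fin => lw l0; have d20 : 0 < d / 2 by rewrite divr_gt0.
have := almost_reached_of_admissible B_skew adm L d20.
rewrite (gmulA B_skew) (gmulVl B_skew) (gmul0l B_skew) E => ar.
have ld0 : 0 <= l + d / 2 by rewrite addr_ge0 // ltW.
apply: le_trans (polydist_semiconcave_of_almost_reached B_skew B_span h ld0 ar) _.
have : (l + d / 2) ^+ 2 <= (D p + d) ^+ 2.
  by rewrite ler_pXn2r ?nnegrE ?addr_ge0 // ?ltW //; lra.
have : d * d <= d * 1 by rewrite ler_wpM2l // ltW.
have -> : (D p + d) ^+ 2 = D p ^+ 2 + 2 * (d * D p) + d * d by ring.
clearbody d; set X := (_ + d / 2) ^+ 2; set Y := D p ^+ 2; set Z := _ * enorm h ^+ 2; lra.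
Qed.

Lemma polydist_hor_le p h : D (p ** hor n2 h) <= D p + enorm h.
Proof.
apply: le_trans (polydistM B_skew B_span _ _) _.
by rewrite lerD2l polydist_hor.
Qed.

Lemma polydist_hor_dist p h : (D (p ** hor n2 h) - D p) ^+ 2 <= enorm h ^+ 2.
Proof.
have le1 := polydist_hor_le p h; have le2 := polydist_hor_le (p ** hor n2 h) (- h).
rewrite -(gmulA B_skew) -ginv_hor (gmulVr B_skew) (gmul0r B_skew) enormN in le2.
rewrite -real_normK ?num_real // ler_pXn2r ?nnegrE ?enorm_ge0 // ler_norml.
by apply/andP; split; lra.
Qed.

Context (g : G -> R) (M : R) (g_bounded : forall p, `|g p| <= M).
Context (Phi : R -> R) (t : R) (t0 : 0 < t).
Hypothesis Phi_nonneg : forall tau, 0 <= tau -> 0 <= Phi tau.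
Hypothesis Phi_cont : {within `[0, +oo[, continuous Phi}.
Hypothesis Phi0 : Phi 0 = 0.
Hypothesis Phi_coercive : Phi tau / tau @[tau --> +oo] --> +oo.
Hypothesis Phi_convex : loc_strongly_convex (fun s => Phi `|s|).
Local Notation conj := (conjugate Phi).
Local Notation u := (hopf_lax B g Phi t).

Definition hopf_lax_cost p q : R := g q + t * conj (D (ginv q ** p) / t).
Local Notation f := hopf_lax_cost.

(** Inversion symmetry rewrites the cost through [q^-1 p], on which replacing [p] by [p h] acts as
    right multiplication by [h]. *)
Lemma hopf_laxE p : u p = inf [set f p q | q in [set: G]].
Proof.
congr inf; apply: eq_imagel => q _; rewrite /f (ccdistE B_skew B_span).
by rewrite -(polydistV B_skew B_span (ginv p ** q)) (ginvM B_skew) ginvK.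
Qed.

Let g_le q : - M <= g q /\ g q <= M.
Proof. by have := g_bounded q; rewrite ler_norml => /andP[]. Qed.

Lemma hopf_lax_cost_ge p q : - M <= f p q.
Proof. by have [gM _] := g_le q; rewrite ler_wpDr ?mulr_ge0 ?conjugate_ge0 // ltW. Qed.

Lemma hopf_lax_le p q : u p <= f p q.
Proof.
rewrite hopf_laxE; apply: ge_inf; last by exists q.
by exists (- M) => _ [q' _ <-]; apply: hopf_lax_cost_ge.
Qed.

Lemma hopf_lax_bounded p : - M <= u p <= M.
Proof.
apply/andP; split.
  rewrite hopf_laxE; apply: lb_le_inf; first by exists (f p p), p.
  by move=> _ [q' _ <-]; apply: hopf_lax_cost_ge.
apply: le_trans (hopf_lax_le p p) _; rewrite /f (gmulVl B_skew).
have -> : D (0, 0) = 0.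
  by apply/eqP; rewrite eq_le polydist_ge0 andbT -(enorm0 R m.+1) polydist_hor.
by rewrite mul0r (conjugate0 Phi_nonneg) // mulr0 addr0; case: (g_le p).
Qed.

(** Testing the conjugate with [tau = 1] gives [t * conj (D / t) >= D - t * Phi 1]; the bounds on
    [g] and [u] contribute [2 M], and near optimality 1. *)
Definition near_radius : R := 2 * M + 1 + t * Phi 1.

Lemma hopf_lax_near_optimal p e : 0 < e -> e <= 1 ->
  exists2 q, f p q < u p + e & D (ginv q ** p) <= near_radius.
Proof.
move=> e0 e1; rewrite hopf_laxE.
have [_ [q _ <-]] : exists2 x, [set f p q | q in [set: G]] x &
    x < inf [set f p q | q in [set: G]] + e.
  apply: inf_adherent => //; split; first by exists (f p p), p.
  by exists (- M) => _ [q' _ <-]; apply: hopf_lax_cost_ge.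
rewrite -hopf_laxE => lt; exists q => //.
have /andP[_ uM] := hopf_lax_bounded p; have [gM _] := g_le q.
have := conjugate_ge Phi_cont Phi0 Phi_coercive (D (ginv q ** p) / t) (@ler01 R).
rewrite mulr1 -(ler_pM2l t0) mulrBr [t * (_ / t)]mulrC divfK ?gt_eqF //.
move: lt; rewrite /f /near_radius; lra.
Qed.

(** Only [u p <= u p' + small] is needed, so [q] is chosen nearly optimal for the nearby point [p']
    and then tested at [p]. *)
Lemma hopf_lax_lower_semicontinuous : lower_semicontinuous (fun p => (u p)%:E).
Proof.
have combine (x y r gq a b c d : R) : x <= gq + a -> a <= b + c -> gq + b < y + d ->
    c <= (x - r) / 4 -> d <= (x - r) / 4 -> 0 < x - r -> r < y by lra.
move=> p r; rewrite lte_fin => ru.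
set S := (near_radius + 1) / t.
have [K K0 HK] := conjugate_lipschitz Phi_cont Phi0 Phi_coercive S.
set e := u p - r; have e0 : 0 < e by rewrite subr_gt0.
set theta := Num.min 1 (e / (4 * K)).
have th0 : 0 < theta by rewrite lt_min ltr01 divr_gt0 // mulr_gt0.
have th1 : theta <= 1 by rewrite ge_min lexx.
have thK : K * theta <= e / 4.
  have : theta <= e / (4 * K) by rewrite ge_min lexx orbT.
  by rewrite ler_pdivlMr ?mulr_gt0 //; lra.
have [d d0 Hd] := polydist_continuous B_skew B_span p th0.
have [d1 d10 Hd1] := enorm_ball p.1 d0; have [d2 d20 Hd2] := enorm_ball p.2 d0.
exists (ball p (Num.min d1 d2)); first by apply: nbhsx_ballx; rewrite lt_min d10.
move=> p' [b1 b2]; rewrite lte_fin.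
have near_p : D (ginv p' ** p) <= theta.
  apply: Hd; [apply: Hd1; apply: le_ball b1 | apply: Hd2; apply: le_ball b2].
    by rewrite ge_min lexx.
  by rewrite ge_min lexx orbT.
set e1 := Num.min 1 (e / 4).
have e10 : 0 < e1 by rewrite lt_min ltr01 divr_gt0.
have e11 : e1 <= 1 by rewrite ge_min lexx.
have e14 : e1 <= e / 4 by rewrite ge_min lexx orbT.
have [q fq Dq] := hopf_lax_near_optimal p' e10 e11.
have tri : D (ginv q ** p) <= D (ginv q ** p') + theta.
  have -> : ginv q ** p = (ginv q ** p') ** (ginv p' ** p).
    rewrite -(gmulA B_skew) (gmulA B_skew p') (gmulVr B_skew).
    by rewrite (gmul0l B_skew).
  by apply: le_trans (polydistM B_skew B_span _ _) _; rewrite lerD2l.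
have up := hopf_lax_le p q.
have le1 : conj (D (ginv q ** p) / t) <= conj ((D (ginv q ** p') + theta) / t).
  by apply: conjugate_mono => //; rewrite ler_pM2r ?invr_gt0.
have le2 : conj ((D (ginv q ** p') + theta) / t) <=
    conj (D (ginv q ** p') / t) + K * (theta / t).
  have := HK ((D (ginv q ** p') + theta) / t) (D (ginv q ** p') / t).
  rewrite !ler_pM2r ?invr_gt0 // lerDl (ltW th0) lerD // => /(_ isT isT).
  by rewrite -mulrBl [_ + theta]addrC addrK.
have le3 : t * conj (D (ginv q ** p) / t) <= t * conj (D (ginv q ** p') / t) + K * theta.
  have -> : K * theta = t * (K * (theta / t)) by field; rewrite gt_eqF.
  by rewrite -mulrDr ler_pM2l // (le_trans le1 le2).
exact: combine up le3 fq thK e14 e0.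
Qed.

Lemma hopf_lax_semiconcave : exists2 C : R, 0 <= C & forall p h,
  u (p ** hor n2 h) + u (p ** ginv (hor n2 h)) - 2 * u p <= C * enorm h ^+ 2.
Proof.
have bound (x y z c c' : R) : x <= M -> y <= M -> - M <= z -> 0 <= c ->
    4 * M * 1 <= c' -> x + y - 2 * z <= c + c' by lra.
have combine (x y z gq x' y' z' c e eps : R) : e <= eps / 2 ->
    x' + y' - 2 * z' <= c -> x <= gq + x' -> y <= gq + y' -> gq + z' < z + e ->
    x + y - 2 * z <= c + eps by lra.
set S := (near_radius + 1) / t; set C0 := semiconcavity_bound R m.
have [k k0 Hk] := conjugate_semiconcave Phi_nonneg Phi_cont Phi0 Phi_coercive Phi_convex S.
have M0 : 0 <= M by exact: le_trans (normr_ge0 _) (g_bounded (0, 0)).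
(* [C0] comes from the squared distance and 2 from the squared increments of the distance along [h]
   and [- h]; scaling contributes [t * t^-2]. *)
set C1 := k * (C0 + 2) / t.
have C00 : 0 <= C0 by exact: semiconcavity_bound_ge0.
have C10 : 0 <= C1 by exact: divr_ge0 (mulr_ge0 k0 (addr_ge0 C00 (ler0n _ 2))) (ltW t0).
exists (C1 + 4 * M); first by rewrite addr_ge0 // mulr_ge0.
move=> p h; rewrite ginv_hor; set nh := enorm h; have nh0 : 0 <= nh by exact: enorm_ge0.
have Mnh : 0 <= 4 * M * nh ^+ 2 by rewrite !mulr_ge0 ?sqr_ge0.
have C1nh : 0 <= C1 * nh ^+ 2 by exact: mulr_ge0 C10 (sqr_ge0 nh).
(* For |h| >= 1 the oscillation bound [4 M] suffices. For |h| <= 1 all three distances stay below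
   [near_radius + 1], as [S] requires. *)
have [h1|/ltW h1] := leP nh 1; last first.
  have /andP[_ u1] := hopf_lax_bounded (p ** hor n2 h).
  have /andP[_ u2] := hopf_lax_bounded (p ** hor n2 (- h)).
  have /andP[u3 _] := hopf_lax_bounded p.
  have Mnh1 : 4 * M * 1 <= 4 * M * nh ^+ 2.
    by rewrite ler_wpM2l ?mulr_ge0 // expr_ge1.
  by rewrite (mulrDl C1); exact: bound u1 u2 u3 C1nh Mnh1.
apply: (@le_trans _ _ (C1 * nh ^+ 2)); last by rewrite mulrDl lerDl.
apply/ler_addgt0Pr => eps eps0.
set e := Num.min 1 (eps / 2).
have e0 : 0 < e by rewrite lt_min ltr01 divr_gt0.
have e1 : e <= 1 by rewrite ge_min lexx.
have e2 : e <= eps / 2 by rewrite ge_min lexx orbT.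
have [q fq Dq] := hopf_lax_near_optimal p e0 e1.
have up := hopf_lax_le (p ** hor n2 h) q; have um := hopf_lax_le (p ** hor n2 (- h)) q.
move: up um fq; rewrite /f !(gmulA B_skew); set P := ginv q ** p in Dq *.
have hnh : enorm (- h) = nh by rewrite enormN.
have sc := polydist_semiconcave P h.
have dp := polydist_hor_dist P h; have dm := polydist_hor_dist P (- h).
have lp := polydist_hor_le P h; have lm := polydist_hor_le P (- h).
rewrite hnh in dm lm; rewrite -/nh in sc dp lp; rewrite -/C0 in sc.
have c0 := polydist_ge0 B P.
move: (D (P ** hor n2 h)) (D (P ** hor n2 (- h))) (D P) => a b c in sc dp dm lp lm c0 Dq *.
have ti : 0 < t^-1 by rewrite invr_gt0.
have ti2 : 0 <= t^-1 ^+ 2 by exact: sqr_ge0.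
have key : conj (a / t) + conj (b / t) - 2 * conj (c / t) <= k * ((C0 + 2) * nh ^+ 2 * t^-1 ^+ 2).
  apply: le_trans (Hk (a / t) (b / t) (c / t) (C0 * nh ^+ 2 * t^-1 ^+ 2) _ _ _ _ _) _.
  - exact: mulr_ge0 (mulr_ge0 C00 (sqr_ge0 nh)) ti2.
  - by rewrite ler_pM2r //; lra.
  - by rewrite ler_pM2r //; lra.
  - by rewrite divr_ge0 ?(ltW t0) // ler_pM2r //; lra.
  - by rewrite !exprMn (mulrA 2) -!mulrDl ler_wpM2r.
  - rewrite ler_wpM2l // -!mulrBl !exprMn -!mulrDl ler_wpM2r //; lra.
have C1E : C1 * nh ^+ 2 = t * (k * ((C0 + 2) * nh ^+ 2 * t^-1 ^+ 2)).
  by rewrite /C1; field; rewrite gt_eqF.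
have tkey := ler_wpM2l (ltW t0) key; rewrite -C1E mulrBr mulrDr mulrCA in tkey.
by move=> up um fq; exact: combine e2 tkey up um fq.
Qed.

End HopfLax.

Theorem theorem6p4 (R : realType) (m n2 : nat)
  (B : 'rV[R]_m -> 'rV[R]_m -> 'rV[R]_n2)
  (n2_pos : (0 < n2)%N)
  (B_skew : skew_bilinear B) (B_span : B_spanning B)
  (g : carnot_pt R m n2 -> R)
  (g_bounded : exists M : R, forall p, `|g p| <= M)
  (g_lsc : lower_semicontinuous (fun x => (g x)%:E))
  (Phi : R -> R)
  (Phi_nonneg : forall tau, 0 <= tau -> 0 <= Phi tau)
  (Phi_cont : {within `[0, +oo[, continuous Phi})
  (Phi_convex : forall x y lam, 0 <= x -> 0 <= y -> 0 <= lam <= 1 ->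
      Phi (lam * x + (1 - lam) * y) <= lam * Phi x + (1 - lam) * Phi y)
  (Phi_nondecr : forall x y, 0 <= x -> x <= y -> Phi x <= Phi y)
  (Phi0 : Phi 0 = 0)
  (Phi_coercive : Phi tau / tau @[tau --> +oo] --> +oo)
  (Phi_lsc : loc_strongly_convex (fun s => Phi `|s|))
  (t : R) (t_pos : 0 < t) :
  h_semiconcave B (hopf_lax B g Phi t).
Proof.
have [M gM] := g_bounded.
(* If [m = 0] then [B] vanishes and cannot span a nonzero second layer; the matrix ring used above
   needs dimension [m.+1]. *)
case: m B B_skew B_span g gM {g_bounded g_lsc} => [|k] B' B'_skew B'_span g' gM.
  have [l [xs [ys E]]] := B'_span (const_mx 1).
  have /rowP/(_ (Ordinal n2_pos)) := E; rewrite mxE summxE big1 => [/eqP|i _].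
    by rewrite oner_eq0.
  by rewrite (thinmx0 (xs i)) (skew0l B'_skew) mxE.
split; first exact: (hopf_lax_lower_semicontinuous B'_skew B'_span gM t_pos).
exact: (hopf_lax_semiconcave B'_skew B'_span gM t_pos).
Qed.
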